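(* If $\phi\in\mathcal{I}$, the family of Fock spaces $\{\mathcal{F}^\phi_p\}_{p>0}$ is not nested. In fact, $\mathcal{F}^\phi_p\setminus\mathcal{F}^\phi_q\ne\emptyset$ and $\mathcal{F}^\phi_q\setminus\mathcal{F}^\phi_p\ne\emptyset$ for all $p,q>0$ with $p\ne q$.
   Context: $dm$ is Lebesgue area measure on $\mathbb{C}$. A function $\phi:[0,\infty)\to\mathbb{R}^+=[0,\infty)$ is extended radially to $\mathbb{C}$ by $\phi(z)=\phi(|z|)$, and $\Delta\phi(z)=\phi''(|z|)+\phi'(|z|)/|z|$ for $z\ne0$. For $0<p<\infty$, the weighted Fock space $\mathcal{F}^\phi_p$ is the set of entire functions $f$ with $\|f\|^p_{\mathcal{F}^\phi_p}=\int_{\mathbb{C}}|f(z)|^pe^{-p\phi(z)}\,dm(z)<\infty$. $E_1\asymp E_2$ means that there is a constant $k>0$ independent of the argument with $\frac1kE_1\le E_2\le kE_1$. The class $\mathcal{I}$ of rapidly increasing functions: $\phi\in\mathcal{I}$ if $\phi:[0,\infty)\to\mathbb{R}^+$ is twice continuously differentiable, $\Delta\phi>0$ (on $\mathbb{C}\setminus\{0\}$), and there is a radial positive differentiable function $\tau(z)=\tau(|z|)$ on $\mathbb{C}$ such that $\tau(z)\asymp1$ for $|z|<1$, $\tau(z)\asymp(\Delta\phi(z))^{-1/2}$ for $|z|\ge1$, $\tau(r)$ decreases to $0$ as $r\to\infty$, $\lim_{r\to\infty}\tau'(r)=0$, and either there is a constant $C>0$ such that $\tau(r)r^C$ increases for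 large $r$, or $\lim_{r\to\infty}\tau'(r)\log\frac1{\tau(r)}=0$. *)

(* Defs.v *)
From HB Require Import structures.
From mathcomp Require Import all_boot all_order all_algebra.
From mathcomp Require Import all_classical all_reals all_analysis.
From mathcomp Require Export complex.

Set Implicit Arguments.
Unset Strict Implicit.
Unset Printing Implicit Defensive.

Import Order.TTheory GRing.Theory Num.Theory.
Import numFieldNormedType.Exports.

Local Open Scope classical_set_scope.
Local Open Scope ring_scope.

(* All notions are those of MathComp-Analysis over an arbitrary realType. *)
Section Definitions.
Variable R : realType.

(* Real-valued modulus; the library's `|z| on R[i] takes values in R[i]. *)
Definition cmod (z : R[i]) : R := ComplexField.Normc.normc z.

(* Identification of the plane R * R, which carries area measure, with R[i]. *)
Definition toC (w : R * R) : R[i] := Complex w.1 w.2.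

Definition comparable_on (T : Type) (A : set T) (E1 E2 : T -> R) : Prop :=
  exists2 k : R, 0 < k &
    forall z, A z -> k^-1 * E1 z <= E2 z /\ E2 z <= k * E1 z.

(* Functions on [0, +oo[ are represented by total functions on R whose values
   at negative arguments are never consulted: the derivative is taken relative
   to [0, +oo[, hence is one-sided at 0. *)
Definition quot0y (f : R -> R) (x y : R) : R := (f y - f x) / (y - x).

Definition derivable0y (f : R -> R) (x : R) : Prop :=
  cvg (quot0y f x y @[y --> within `[0, +oo[ x^']).

Definition derive0y (f : R -> R) (x : R) : R :=
  lim (quot0y f x y @[y --> within `[0, +oo[ x^']).

Definition C2_0y (f : R -> R) : Prop :=
  [/\ forall x : R, 0 <= x -> derivable0y f x,
      forall x : R, 0 <= x -> derivable0y (derive0y f) x &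
      {within `[0, +oo[, continuous (derive0y (derive0y f))}].

(* Laplacian of z |-> phi |z|; meaningful for z != 0. *)
Definition laplacian (phi : R -> R) (z : R[i]) : R :=
  derive0y (derive0y phi) (cmod z) + derive0y phi (cmod z) / cmod z.

(* Radial functions on the plane are given by their profile on [0, +oo[.  The
   differentiability of tau is real differentiability on the whole plane. *)
Definition rapidly_increasing (phi : R -> R) : Prop :=
  [/\ forall r : R, 0 <= r -> 0 <= phi r,
      C2_0y phi,
      forall z : R[i], z != 0 -> 0 < laplacian phi z &
      exists tau : R -> R,
        [/\ forall r : R, 0 <= r -> 0 < tau r,
            forall w : R * R,
              differentiable (fun v : R * R => tau (cmod (toC v))) w,
            comparable_on [set z | cmod z < 1]
              (fun z => tau (cmod z)) (fun _ => 1) /\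
            comparable_on [set z | 1 <= cmod z]
              (fun z => tau (cmod z)) (fun z => laplacian phi z `^ (- 2^-1)),
            (forall r s : R, 0 <= r -> r <= s -> tau s <= tau r) /\
            (tau r @[r --> +oo] --> (0 : R)) &
            (derive1 tau r @[r --> +oo] --> (0 : R)) /\
            ((exists2 c : R, 0 < c & exists r0 : R, forall r s : R,
                 0 < r -> r0 <= r -> r <= s ->
                 tau r * r `^ c <= tau s * s `^ c) \/
             (derive1 tau r * ln (1 / tau r) @[r --> +oo] --> (0 : R)))]].

(* Complex differentiability at every point: R[i]^o is R[i] as a normed space
   over itself, so the increments range over R[i]. *)
Definition entire (f : R[i] -> R[i]) : Prop :=
  forall z : R[i], @derivable R[i] R[i]^o R[i]^o f z 1.

Definition area :
    {measure set (measurableTypeR R * measurableTypeR R) -> \bar R} :=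
  (@lebesgue_measure R \x @lebesgue_measure R)%E.

Definition fock_norm_pow (phi : R -> R) (p : R) (f : R[i] -> R[i]) : \bar R :=
  (\int[area]_w
     (cmod (f (toC w)) `^ p * expR (- p * phi (cmod (toC w))))%:E)%E.

Definition fock (phi : R -> R) (p : R) : set (R[i] -> R[i]) :=
  [set f | entire f /\ (fock_norm_pow phi p f < +oo)%E].

(* A family of sets indexed by the positive reals is nested when its members
   are pairwise comparable for inclusion. *)
Definition nested (T : Type) (F : R -> set T) : Prop :=
  forall p q : R, 0 < p -> 0 < q -> F p `<=` F q \/ F q `<=` F p.

End Definitions.

(* Main.v *)
(* Let F(t) = phi(e^t) and d(t) = tau(e^t)/e^t.  Since tau'(r) -> 0, F'' is
   comparable to d(t)^-2 on every window |s - t| <= X d(t), t large, with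
   constants independent of X.  By convexity F therefore lies above its tangent
   at t by at least (K/d(t))|s - t| - C, for every K.

   (p < q, function in F_p but not in F_q.)  At a = e^t let m be the integer
   part of F'(t), N ~ 1/d(t), and take the polynomial
   e^phi(a) (z/a)^m ((1 + z/a + ... + (z/a)^(N-1))/N)^k.  Its product with
   e^-phi is bounded by C min(1, tau(a)/|z - a|)^k and bounded below on a square
   of side comparable to tau(a) -> 0.

   (q < p.)  Let t_(j+1) = t_j + d(t_j) and let n_j be the integer part of
   F'(t_j).  The normalised monomials e^phi(r_j) (z/r_j)^n_j, r_j = e^t_j, times
   e^-phi, have modulus at most comparable to 1, decay geometrically in |i - j|
   on |z| ~ r_i and are bounded below there for j = i.  Hence every sum over a
   subset of {0,...,K} is O(e^phi) and decays beyond r_K, and averaging over all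
   subsets yields one whose q-th integral over a rectangle in |z| <= r_K is
   comparable to r_K^2, where r_K -> oo.

   After scaling by a suitable power of tau(a), resp. r_K, both families have
   small p-integral, large q-integral on a bounded set and small values on a
   given disc.  As all coefficients are nonnegative, a sparse series of such
   polynomials is entire, and a gliding hump argument puts it in F_p but not
   in F_q. *)

Require Import Defs.
From mathcomp Require Import all_boot all_order all_algebra.
From mathcomp Require Import all_classical all_reals all_analysis.
From mathcomp Require Import measurable_realfun.
From mathcomp Require Import ring lra.

Set Implicit Arguments.
Unset Strict Implicit.
Unset Printing Implicit Defensive.

Import Order.TTheory GRing.Theory Num.Theory.
Import numFieldNormedType.Exports.

Local Open Scope classical_set_scope.
Local Open Scope ring_scope.

(** * Modulus and polynomials on the complex plane *)

Section Modulus.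
Variable R : realType.
Implicit Types z w : R[i].

Lemma cmod_ge0 z : 0 <= cmod z.
Proof. by case: z => a b; exact: sqrtr_ge0. Qed.

Lemma cmod0 : cmod (0 : R[i]) = 0.
Proof. exact: ComplexField.Normc.normc0. Qed.

Lemma cmod1 : cmod (1 : R[i]) = 1.
Proof. exact: ComplexField.Normc.normc1. Qed.

Lemma cmod_eq0 z : cmod z = 0 -> z = 0.
Proof. exact: ComplexField.Normc.eq0_normc. Qed.

Lemma cmodM z w : cmod (z * w) = cmod z * cmod w.
Proof. exact: ComplexField.Normc.normcM. Qed.

Lemma cmodV z : cmod z^-1 = (cmod z)^-1.
Proof. exact: ComplexField.Normc.normcV. Qed.

Lemma cmodX z n : cmod (z ^+ n) = cmod z ^+ n.
Proof. by elim: n => [|n ih]; rewrite ?expr0 ?cmod1// !exprS cmodM ih. Qed.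

Lemma cmodD z w : cmod (z + w) <= cmod z + cmod w.
Proof. exact: le_normcD. Qed.

Lemma cmodN z : cmod (- z) = cmod z.
Proof. exact: normcN. Qed.

Lemma cmodB z w : cmod (z - w) <= cmod z + cmod w.
Proof. by rewrite -(cmodN w); exact: cmodD. Qed.

Lemma cmod_real (x : R) : cmod (real_complex R x) = `|x|.
Proof. by rewrite /cmod /= expr0n /= addr0 sqrtr_sqr. Qed.

Lemma cmod_sum (I : Type) (s : seq I) (P : pred I) (F : I -> R[i]) :
  cmod (\sum_(i <- s | P i) F i) <= \sum_(i <- s | P i) cmod (F i).
Proof.
elim/big_ind2: _ => [|x a y b xa yb|//]; first by rewrite cmod0.
by rewrite (le_trans (cmodD _ _)) ?lerD.
Qed.

Lemma Re_sum (I : Type) (s : seq I) (P : pred I) (F : I -> R[i]) :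
  complex.Re (\sum_(i <- s | P i) F i) = \sum_(i <- s | P i) complex.Re (F i).
Proof.
have D : {morph @complex.Re R : z w / z + w} by case=> ? ? [].
exact: (big_morph _ D).
Qed.

Lemma Im_sum (I : Type) (s : seq I) (P : pred I) (F : I -> R[i]) :
  complex.Im (\sum_(i <- s | P i) F i) = \sum_(i <- s | P i) complex.Im (F i).
Proof.
have D : {morph @complex.Im R : z w / z + w} by case=> ? ? [].
exact: (big_morph _ D).
Qed.

Lemma cmod_sqr z : cmod z ^+ 2 = complex.Re z ^+ 2 + complex.Im z ^+ 2.
Proof. by case: z => a b; rewrite sqr_sqrtr ?addr_ge0 ?sqr_ge0. Qed.

Lemma cmod_ge_Re z : `|complex.Re z| <= cmod z.
Proof.
rewrite -(@ler_pXn2r _ 2) ?nnegrE ?cmod_ge0//.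
by rewrite cmod_sqr -normrX ger0_norm ?sqr_ge0// lerDl sqr_ge0.
Qed.

Lemma cmod_ge_Im z : `|complex.Im z| <= cmod z.
Proof.
rewrite -(@ler_pXn2r _ 2) ?nnegrE ?cmod_ge0//.
by rewrite cmod_sqr -normrX ger0_norm ?sqr_ge0// lerDr sqr_ge0.
Qed.

Lemma cmod_le_ReIm z : cmod z <= `|complex.Re z| + `|complex.Im z|.
Proof.
rewrite -(@ler_pXn2r _ 2) ?nnegrE ?cmod_ge0// ?addr_ge0//.
by rewrite cmod_sqr sqrrD !real_normK ?num_real// lerD2r lerDl mulrn_wge0 ?mulr_ge0.
Qed.

Lemma normCE z : `|z| = real_complex R (cmod z).
Proof. by []. Qed.

End Modulus.

(** * Polynomials with nonnegative coefficients at complex points *)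

Section PolyEval.
Variable R : realType.
Implicit Types (P Q : {poly R}) (z h : R[i]).

Definition pev P z : R[i] := (map_poly (real_complex R) P).[z].

Lemma pevD P Q z : pev (P + Q) z = pev P z + pev Q z.
Proof. by rewrite /pev rmorphD hornerD. Qed.

Lemma pevM P Q z : pev (P * Q) z = pev P z * pev Q z.
Proof. by rewrite /pev rmorphM hornerM. Qed.

Lemma pev_exp P n z : pev (P ^+ n) z = pev P z ^+ n.
Proof. by rewrite /pev rmorphXn horner_exp. Qed.

Lemma pevX z : pev 'X z = z.
Proof. by rewrite /pev map_polyX hornerX. Qed.

Lemma pevC (c : R) z : pev c%:P z = real_complex R c.
Proof. by rewrite /pev map_polyC hornerC. Qed.

Lemma pevZ (c : R) P z : pev (c *: P) z = real_complex R c * pev P z.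
Proof. by rewrite -mul_polyC pevM pevC. Qed.

Lemma pev0 z : pev 0 z = 0.
Proof. by rewrite /pev rmorph0 horner0. Qed.

Lemma pev_sum (I : Type) (s : seq I) (A : pred I) (F : I -> {poly R}) z :
  pev (\sum_(i <- s | A i) F i) z = \sum_(i <- s | A i) pev (F i) z.
Proof. by rewrite /pev rmorph_sum horner_sum. Qed.

Lemma pevE P z :
  pev P z = \sum_(i < size P) real_complex R P`_i * z ^+ i.
Proof.
rewrite /pev horner_coef size_map_inj_poly ?rmorph0//; last exact: complexI.
by apply: eq_bigr => i _; rewrite coef_map.
Qed.

Lemma pev_real P (x : R) : pev P (real_complex R x) = real_complex R P.[x].
Proof. by rewrite /pev horner_map. Qed.

Definition nneg_poly P : Prop := forall i, 0 <= P`_i.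

Lemma nneg_poly_sum (I : Type) (s : seq I) (A : pred I) (F : I -> {poly R}) :
  (forall i, nneg_poly (F i)) -> nneg_poly (\sum_(i <- s | A i) F i).
Proof. by move=> F0 i; rewrite coef_sum sumr_ge0// => j _; exact: F0. Qed.

Lemma nneg_polyM P Q : nneg_poly P -> nneg_poly Q -> nneg_poly (P * Q).
Proof. by move=> P0 Q0 i; rewrite coefM sumr_ge0// => j _; rewrite mulr_ge0. Qed.

Lemma nneg_polyC (c : R) : 0 <= c -> nneg_poly c%:P.
Proof. by move=> c0 i; rewrite coefC; case: ifP. Qed.

Lemma nneg_polyX : nneg_poly 'X.
Proof. by move=> i; rewrite coefX ler0n. Qed.

Lemma nneg_poly_exp P n : nneg_poly P -> nneg_poly (P ^+ n).
Proof.
move=> P0; elim: n => [|n ih]; first by rewrite expr0 -polyC1; exact: nneg_polyC.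
by rewrite exprS; exact: nneg_polyM.
Qed.

Lemma nneg_polyZ (c : R) P : 0 <= c -> nneg_poly P -> nneg_poly (c *: P).
Proof. by move=> c0 P0 i; rewrite coefZ mulr_ge0. Qed.

Lemma horner_nneg_ge0 P (x : R) : nneg_poly P -> 0 <= x -> 0 <= P.[x].
Proof.
move=> P0 x0; rewrite horner_coef sumr_ge0// => i _.
by rewrite mulr_ge0 ?exprn_ge0.
Qed.

Lemma cmod_pev P z : nneg_poly P -> cmod (pev P z) <= P.[cmod z].
Proof.
move=> P0; rewrite pevE horner_coef (le_trans (cmod_sum _ _ _))//.
by rewrite ler_sum// => i _; rewrite cmodM cmodX cmod_real ger0_norm.
Qed.

Lemma horner_nneg_le P (x y : R) :
  nneg_poly P -> 0 <= x -> x <= y -> P.[x] <= P.[y].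
Proof.
move=> P0 x0 xy; rewrite !horner_coef ler_sum// => i _.
have y0 := le_trans x0 xy.
by rewrite ler_wpM2l ?lerXn2r ?nnegrE.
Qed.

Lemma nneg_poly_nderivn P n : nneg_poly P -> nneg_poly P^`N(n).
Proof.
move=> P0 i.
by rewrite coef_nderivn mulrn_wge0.
Qed.

Lemma pev_taylor P z h :
  pev P (z + h) = \sum_(i < size P) pev P^`N(i) z * h ^+ i.
Proof.
rewrite /pev nderiv_taylor; last exact: mulrC.
rewrite size_map_inj_poly ?rmorph0//; last exact: complexI.
by apply: eq_bigr => i _; rewrite nderivn_map.
Qed.

(** Taylor expansion with step 1. For nonnegative coefficients and [x >= 0] all summands are
    nonnegative, so the value at [x + 1] dominates every divided derivative at [x] and all their
    partial sums. *)
Lemma nderivn_sum1 P (x : R) :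
  \sum_(i < size P) P^`N(i).[x] = P.[x + 1].
Proof.
rewrite nderiv_taylor; last exact: mulrC.
by apply: eq_bigr => i _; rewrite expr1n mulr1.
Qed.

Lemma cmod_pev_deriv P z : nneg_poly P -> cmod (pev P^`N(1) z) <= P.[cmod z + 1].
Proof.
move=> P0; rewrite -nderivn_sum1 (le_trans (cmod_pev _ (nneg_poly_nderivn 1 P0)))//.
have [lt1|ge1] := ltnP 1 (size P).
  rewrite (bigD1 (Ordinal lt1))//= lerDl sumr_ge0// => i _.
  by apply: horner_nneg_ge0; [exact: nneg_poly_nderivn|exact: cmod_ge0].
rewrite nderivn_poly0// horner0 sumr_ge0// => i _.
by apply: horner_nneg_ge0; [exact: nneg_poly_nderivn|exact: cmod_ge0].
Qed.

(** Every Taylor term of order at least 2 contains [h ^+ 2], and the remaining powers of [h] have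
    modulus at most 1. The bound is linear in [P], so it adds up along a series. *)
Lemma cmod_pev_diff2 P z h : nneg_poly P -> cmod h <= 1 ->
  cmod (pev P (z + h) - pev P z - h * pev P^`N(1) z)
    <= cmod h ^+ 2 * P.[cmod z + 1].
Proof.
move=> P0 h1.
have [->|Pn0] := eqVneq P 0.
  have -> : (0 : {poly R})^`N(1) = 0 by rewrite nderivn_poly0 ?size_poly0.
  by rewrite !pev0 horner0 mulr0 !subrr cmod0 mulr0.
pose u i := pev P^`N(i) z * h ^+ i.
(* Padding by two vanishing terms allows the terms of order 0 and 1 to be split off whatever the
   size of [P]. *)
have taylor : pev P (z + h) = \sum_(i < (size P).+2) u i.
  rewrite pev_taylor !big_ord_recr/= /u !nderivn_poly0// !pev0 !mul0r !addr0.
  by apply: eq_bigr.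
have -> : pev P (z + h) - pev P z - h * pev P^`N(1) z =
    \sum_(i < size P) u i.+2.
  rewrite taylor 2!big_ord_recl /= /bump /= /u expr0 mulr1 expr1 nderivn0.
  by set S := (X in _ + (_ + X)); set S' := RHS; have -> : S = S' by []; ring.
rewrite (le_trans (cmod_sum _ _ _))//.
have le_u i : cmod (u i.+2) <= cmod h ^+ 2 * P^`N(i.+2).[cmod z].
  rewrite cmodM cmodX mulrC -addn2 addnC exprD -mulrA ler_wpM2l ?exprn_ge0 ?cmod_ge0//.
  rewrite -[leRHS]mul1r ler_pM ?cmod_ge0 ?exprn_ge0 ?cmod_ge0//.
    by rewrite exprn_ile1 ?cmod_ge0.
  exact/cmod_pev/nneg_poly_nderivn.
have -> : P.[cmod z + 1] = \sum_(i < (size P).+2) P^`N(i).[cmod z].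
  by rewrite -nderivn_sum1 !big_ord_recr/= !nderivn_poly0// !horner0 !addr0.
apply: le_trans (ler_sum _ (fun (i : 'I_(size P)) _ => le_u i)) _; rewrite -mulr_sumr.
rewrite ler_wpM2l ?exprn_ge0 ?cmod_ge0// 2!big_ord_recl /= addrA lerDr addr_ge0//;
  by apply: horner_nneg_ge0; [exact: nneg_poly_nderivn|exact: cmod_ge0].
Qed.

End PolyEval.

(** * Growth of rapidly increasing weights *)

Section RadialDerivative.
Variable R : realType.

(** A point [x > 0] is interior to the half-line: for increments shorter than [x] the relative
    difference quotient is the ordinary one. *)
Lemma derivable0y_is_derive (f : R -> R) (x : R) : 0 < x -> derivable0y f x ->
  is_derive x 1 f (derive0y f x).
Proof.
move=> x0 df.
have {}df : quot0y f x y @[y --> within `[0, +oo[ x^'] --> derive0y f x by [].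
suff cvq : h^-1 *: (f (h *: 1 + x) - f x) @[h --> 0^'] --> derive0y f x.
  by apply: DeriveDef; [apply/cvg_ex; exists (derive0y f x) | exact: cvg_lim].
apply/cvgrPdist_lt => e e0.
move/cvgrPdist_lt : df => /(_ e e0).
rewrite /prop_near1 /within /= /dnbhs => -[d /= d0 df].
rewrite /within/=; exists (Num.min d x) => /=; first by rewrite lt_min d0.
move=> h /=; rewrite sub0r normrN lt_min => /andP[hd hx] h0.
have := df (h + x); rewrite /= /ball_/= opprD addrCA subrr addr0 normrN.
rewrite /quot0y addrK /GRing.scale /= mulr1 mulrC; apply => //.
  by rewrite -subr_eq0 addrK.
rewrite in_itv/= andbT; move: hx; rewrite ltr_norml => /andP[hx _]; lra.
Qed.

End RadialDerivative.

(* The behaviour of [F t = phi (e^t)] for [phi] rapidly increasing: [G] and [H]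
   are its first two derivatives and [dl t = tau (e^t) / e^t], so that
   [H = e^(2t) * laplacian] is comparable to [dl^-2]. *)
Record regular_growth (R : realType) (F G H dl : R -> R) : Prop := {
  rg_dF : forall t : R, is_derive t (1 : R) F (G t) ;
  rg_dG : forall t : R, is_derive t (1 : R) G (H t) ;
  rg_H : forall t, 0 < H t ;
  rg_dl : forall t, 0 < dl t ;
  rg_bounds : exists c C : R, [/\ 0 < c, 0 < C & forall X : R, 0 < X ->
    exists t0, forall t s, t0 <= t -> `|s - t| <= X * dl t ->
      c / dl t ^+ 2 <= H s /\ H s <= C / dl t ^+ 2] ;
  rg_tau : forall e, 0 < e -> exists t0, forall t, t0 <= t -> expR t * dl t <= e ;
  rg_dl_low : forall B, exists2 e, 0 < e & forall t, 0 <= t -> t <= B -> e <= dl t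
}.

Section RapidlyIncreasing.
Variable R : realType.

(** This is the directional derivative along [(1, 0)]: on the positive half-axis the modulus is the
    coordinate itself. *)
Lemma radial_derivable (tau : R -> R) (r : R) : 0 < r ->
  differentiable (fun v : R * R => tau (cmod (toC v))) (r, 0) ->
  derivable tau r 1.
Proof.
move=> r0 /(@diff_derivable _ (R * R)%type R _ _ ((1, 0) : R * R)).
move=> /cvg_ex[l hl]; apply/cvg_ex; exists l; apply: cvg_trans hl.
apply: near_eq_cvg.
rewrite /prop_near1 /dnbhs /within /=; exists r => //= h /=.
rewrite sub0r normrN => hr _.
have hr0 : 0 < h + r by move: hr; rewrite ltr_norml => /andP[]; lra.
have -> : h *: (1 : R) + r = h + r by rewrite /GRing.scale /= mulr1.
by rewrite scaler0 addr0 expr0n /= !addr0 !sqrtr_sqr !gtr0_norm.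
Qed.

Lemma lipschitz_MVT (f : R -> R) (r0 e : R) :
  (forall r, r0 < r -> derivable f r 1) ->
  (forall r, r0 < r -> `|derive1 f r| <= e) ->
  forall r s, r0 < r -> r0 < s -> `|f r - f s| <= e * `|r - s|.
Proof.
move=> df f1.
have lt_case r s : r0 < r -> r < s -> `|f s - f r| <= e * `|s - r|.
  move=> r0r rs.
  have dfrs x : x \in `]r, s[ -> is_derive x (1 : R) f (derive1 f x).
    rewrite in_itv/= => /andP[rx _]; rewrite derive1E.
    by apply: DeriveDef => //; exact: df (lt_trans r0r rx).
  have cf : {within `[r, s], continuous f}.
    apply: derivable_within_continuous => y; rewrite in_itv/= => /andP[ry _].
    exact: df (lt_le_trans r0r ry).
  have [x] := MVT rs dfrs cf.
  rewrite in_itv/= => /andP[rx _] fE.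
  by rewrite fE normrM ler_wpM2r// f1// (lt_trans r0r).
move=> r s r0r r0s; have [rs|sr|->] := ltgtP r s.
- by rewrite distrC (distrC r); exact: lt_case.
- exact: lt_case.
- by rewrite !subrr normr0 mulr0.
Qed.

Lemma ln_le_expR (x t : R) : ln x <= t -> 0 < x -> x <= expR t.
Proof. by move=> xt x0; rewrite -[leLHS]lnK ?posrE// ler_expR. Qed.

Lemma sqr_powRNhalf (x : R) : 0 < x -> (x `^ (- 2^-1)) ^+ 2 = x^-1.
Proof.
move=> x0; rewrite -powR_mulrn ?powR_ge0// -powRrM.
by rewrite mulNr mulVf// powR_inv1// ltW.
Qed.

(** With [r = e^t] the second derivative of [phi (e^t)] is [r^2] times the Laplacian, hence
    comparable to [(r / tau r)^2]. Since [tau' -> 0], far out [tau] changes by at most a factor 2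
    over a fixed multiple of [tau], so the comparison is uniform on windows. *)
Lemma rapidly_increasing_growth (phi : R -> R) : rapidly_increasing phi ->
  exists G H dl : R -> R, regular_growth (fun t => phi (expR t)) G H dl.
Proof.
move=> [phi0 [dphi d2phi _] lap0 [tau [tau0 dtau [_ [k k0 tauk]]]]].
move=> [tau_dec tau_cvg] [dtau_cvg _].
have le2 (x y : R) : 0 <= x -> x <= y -> x ^+ 2 <= y ^+ 2 by move=> *; nra.
pose phi1 := derive0y phi; pose phi2 := derive0y phi1.
pose lap (r : R) := phi2 r + phi1 r / r.
have lapE (r : R) : 0 < r -> laplacian phi (real_complex R r) = lap r.
  by move=> r0; rewrite /laplacian cmod_real gtr0_norm.
have lap_gt0 (r : R) : 0 < r -> 0 < lap r.
  move=> r0; rewrite -lapE//; apply: lap0; apply/eqP => -[/eqP].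
  by rewrite gt_eqF.
have lap_bounds (r : R) : 1 <= r ->
    (k * tau r) ^- 2 <= lap r /\ lap r <= k ^+ 2 / tau r ^+ 2.
  move=> r1; have r0 : 0 < r by lra.
  have tr0 := tau0 _ (ltW r0).
  have cr : cmod (real_complex R r) = r by rewrite cmod_real gtr0_norm.
  have /tauk : 1 <= cmod (real_complex R r) by rewrite cr.
  rewrite lapE// cr => -[h1 h2]; have l0 := lap_gt0 _ r0.
  have p0 : 0 < lap r `^ (- 2^-1) by exact: powR_gt0.
  have lE : lap r = (lap r `^ (- 2^-1)) ^- 2 by rewrite sqr_powRNhalf// invrK.
  rewrite lE; set L := _ `^ _ in h1 h2 p0 *; split.
    rewrite lef_pV2 ?posrE ?exprn_gt0 ?mulr_gt0//.
    by apply: le2 => //; exact: ltW.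
  rewrite -[k ^+ 2]invrK -invfM lef_pV2 ?posrE ?exprn_gt0 ?mulr_gt0 ?invr_gt0 ?exprn_gt0//.
  by rewrite -exprVn -exprMn; apply: le2 => //; rewrite mulr_ge0 ?invr_ge0// ltW.
pose dl (t : R) := tau (expR t) / expR t.
have dl0 t : 0 < dl t by rewrite divr_gt0 ?expR_gt0// tau0 ?expR_ge0.
exists (fun t => expR t * phi1 (expR t)).
exists (fun t => expR t ^+ 2 * lap (expR t)); exists dl.
have dtau1 r : 0 < r -> derivable tau r 1.
  by move=> r0; exact: radial_derivable.
have tau_small e : 0 < e -> exists2 r0, 1 <= r0 & forall r, r0 <= r -> tau r <= e.
  move=> e0; move/cvgrPdist_le : tau_cvg => /(_ e e0) [M [_ hM]].
  exists (Num.max 1 (M + 1)); first by rewrite le_max lexx.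
  move=> r; rewrite ge_max => /andP[r1 rM].
  have := hM r; rewrite sub0r normrN => /(_ _)/(le_trans (ler_norm _)) -> //.
  lra.
have tau_lip e : 0 < e -> exists2 r0, 1 <= r0 & forall r s, r0 <= r -> r0 <= s ->
    `|tau r - tau s| <= e * `|r - s|.
  move=> e0; move/cvgrPdist_le : dtau_cvg => /(_ e e0) [M [_ hM]].
  exists (Num.max 1 (M + 1)); first by rewrite le_max lexx.
  move=> r s; rewrite !ge_max => /andP[r1 rM] /andP[s1 sM].
  apply: (@lipschitz_MVT _ (Num.max 0 M)); rewrite ?gt_max; do ?by apply/andP; split; lra.
  - by move=> x; rewrite gt_max => /andP[x0 _]; exact: dtau1.
  - by move=> x; rewrite gt_max => /andP[_ /hM]; rewrite sub0r normrN.
split => //.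
- move=> t; rewrite mulrC.
  have := @derivable0y_is_derive _ phi _ (expR_gt0 t) (dphi _ (expR_ge0 t)).
  move=> h; exact: is_derive1_comp.
- move=> t.
  have h := @derivable0y_is_derive _ phi1 _ (expR_gt0 t) (d2phi _ (expR_ge0 t)).
  have h' : is_derive t 1 (phi1 \o expR) (expR t *: phi2 (expR t)).
    by rewrite /GRing.scale /= mulrC; exact: is_derive1_comp.
  apply: is_derive_eq; rewrite /lap /GRing.scale/=; field.
  by rewrite gt_eqF ?expR_gt0.
- by move=> t; rewrite mulr_gt0 ?exprn_gt0 ?lap_gt0 ?expR_gt0.
(* [16 = 4 * 4]: on the window [r] and [tau r] stay within a factor 2 of [a] and [tau a], and both
   enter squared. [X] only affects the threshold. *)
- exists (16 * k ^+ 2)^-1, (16 * k ^+ 2).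
  have k20 : 0 < 16 * k ^+ 2 by rewrite mulr_gt0 ?exprn_gt0.
  split => //; first by rewrite invr_gt0.
  move=> X X0.
  (* On the window [|r - a| <= 2 * X * tau a], so this Lipschitz constant keeps [tau r] within
     [tau a / 2] of [tau a]. *)
  have [r1 r1_ge1 Hr1] := tau_lip (4 * X)^-1 ltac:(rewrite invr_gt0; lra).
  have [r2 r2_ge1 Hr2] := tau_small 1 ltr01.
  (* The threshold gives [a / 2 >= r1], [a >= r2] and [a >= 2 * X]; with [tau a <= 1] the last one
     yields [X * dl t <= 1 / 2]. *)
  exists (ln (2 * r1 + r2 + 2 * X + 2)) => t s /ln_le_expR.
  set a := expR t => /(_ ltac:(lra)) ta; rewrite ler_norml => /andP[s1 s2].
  have a0 : 0 < a by exact: expR_gt0.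
  have ta0 : 0 < tau a by apply: tau0; lra.
  have ta1 : tau a <= 1 by apply: Hr2; lra.
  have Xdl : X * dl t <= 2^-1.
    rewrite /dl -/a mulrA ler_pdivrMr//; nra.
  have Xdl0 : 0 < X * dl t by rewrite mulr_gt0.
  have rE : expR s = a * expR (s - t) by rewrite -expRD; congr expR; ring.
  set u := s - t in s1 s2 rE.
  have u_low : 1 - X * dl t <= expR u.
    by apply: le_trans (expR_ge1Dx _); lra.
  (* From [e^(- u) >= 1 - y] with [y = X * dl t], and [1 / (1 - y) <= 1 + 2 * y] for
     [0 <= y <= 1 / 2]. *)
  have u_up : expR u <= 1 + 2 * (X * dl t).
    have h1 : 1 - X * dl t <= expR (- u).
      by apply: le_trans (expR_ge1Dx _); lra.
    have h2 : expR u * expR (- u) = 1 by rewrite -expRD subrr expR0.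
    have h3 := expR_gt0 u.
    nra.
  set r := expR s in rE *.
  have XtE : a * (X * dl t) = X * tau a.
    by rewrite /dl -/a; field; rewrite gt_eqF.
  have r_low : a - X * tau a <= r.
    by rewrite rE -XtE; nra.
  have r_up : r <= a + 2 * (X * tau a).
    by rewrite rE -XtE; nra.
  have ra2 : a / 2 <= r by rewrite rE; nra.
  have r2a : r <= 2 * a by rewrite rE; nra.
  have r1' : 1 <= r by lra.
  have tr0 : 0 < tau r by apply: tau0; lra.
  have tra : `|tau r - tau a| <= tau a / 2.
    apply: (le_trans (Hr1 _ _ _ _)); [lra|lra|].
    rewrite mulrC ler_pdivrMr ?mulr_gt0//.
    have -> : tau a / 2 * (4 * X) = 2 * (X * tau a) by field.
    rewrite ler_norml; nra.
  move: tra; rewrite ler_norml => /andP[tra1 tra2].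
  have tr_low : tau a / 2 <= tau r by lra.
  have tr_up : tau r <= 2 * tau a by lra.
  have [lp1 lp2] := lap_bounds _ r1'.
  have dlE : dl t ^+ 2 = tau a ^+ 2 / a ^+ 2 by rewrite /dl expr_div_n.
  have ta_neq0 : tau a != 0 by rewrite gt_eqF.
  have tr_neq0 : tau r != 0 by rewrite gt_eqF.
  have a_neq0 : a != 0 by rewrite gt_eqF.
  have k_neq0 : k != 0 by rewrite gt_eqF.
  rewrite dlE; split.
    apply: (@le_trans _ _ (r ^+ 2 * (k * tau r) ^- 2)); last first.
      by rewrite ler_wpM2l ?sqr_ge0.
    have -> : (16 * k ^+ 2)^-1 / (tau a ^+ 2 / a ^+ 2) =
              (a / 2) ^+ 2 * (k * (2 * tau a)) ^- 2.
      by field; rewrite ta_neq0 k_neq0.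
    rewrite ler_pM ?sqr_ge0 ?invr_ge0 ?sqr_ge0//.
      by apply: le2; [rewrite divr_ge0// ltW|exact: ra2].
    rewrite lef_pV2 ?posrE ?exprn_gt0 ?mulr_gt0//.
    by apply: le2; [rewrite mulr_ge0 ?ltW | rewrite ler_pM2l].
  apply: (@le_trans _ _ (r ^+ 2 * (k ^+ 2 / tau r ^+ 2))).
    by rewrite ler_wpM2l ?sqr_ge0.
  have -> : 16 * k ^+ 2 / (tau a ^+ 2 / a ^+ 2) =
            (2 * a) ^+ 2 * (k ^+ 2 * (tau a / 2) ^- 2).
    by field; rewrite ta_neq0.
  apply: ler_pM; rewrite ?sqr_ge0//.
  - by rewrite mulr_ge0 ?invr_ge0 ?sqr_ge0.
  - by apply: le2; [exact: expR_ge0|exact: r2a].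
  rewrite ler_wpM2l ?sqr_ge0// lef_pV2 ?posrE ?exprn_gt0 ?divr_gt0//.
  by apply: le2; [rewrite divr_ge0// ltW|exact: tr_low].
- move=> e /tau_small[r0 r01 hr0]; exists (ln r0) => t /ln_le_expR/(_ ltac:(lra)).
  by move=> /hr0; rewrite /dl mulrCA divff ?mulr1// gt_eqF ?expR_gt0.
- move=> B; exists (tau (expR B) / expR B).
    by rewrite divr_gt0 ?expR_gt0 ?tau0 ?expR_ge0.
  move=> t _ tB; rewrite /dl ler_pM ?invr_ge0 ?expR_ge0//.
  + by rewrite ltW// tau0 ?expR_ge0.
  + by apply: tau_dec; rewrite ?expR_ge0// ler_expR.
  + by rewrite lef_pV2 ?posrE ?expR_gt0// ler_expR.
Qed.

End RapidlyIncreasing.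

(** * Convexity estimates for [F] relative to its tangents *)

Section RegularGrowth.
Variables (R : realType) (F G H dl : R -> R).
Hypothesis rg : regular_growth F G H dl.

Let MVT_total (f df : R -> R) : (forall t : R, is_derive t (1 : R) f (df t)) ->
  forall s t, s < t ->
  exists x, [/\ s < x, x < t & f t - f s = df x * (t - s)].
Proof.
move=> fdf s t st.
have cf : {within `[s, t], continuous f}.
  by apply: derivable_within_continuous => y _.
have [x] := MVT st (fun x _ => fdf x) cf.
by rewrite in_itv/= => /andP[sx xt] fE; exists x.
Qed.

Lemma slope_le s t : s <= t -> G s <= G t.
Proof.
rewrite le_eqVlt => /predU1P[->//|st].
have [x [_ _]] := MVT_total (rg_dG rg) st.
have := rg_H rg x; nra.
Qed.

Lemma tangent_below t s : F t + G t * (s - t) <= F s.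
Proof.
have [st|ts|->] := ltgtP s t; last lra.
- have [x [_ xt FE]] := MVT_total (rg_dF rg) st.
  have := slope_le (ltW xt); nra.
- have [x [tx _ FE]] := MVT_total (rg_dF rg) ts.
  have := slope_le (ltW tx); nra.
Qed.

(** Two applications of the mean value theorem bound the excess over the tangent by
    [C / dl t ^+ 2 * |s - t|^2], which is at most [C] within one step. *)
Lemma tangent_near : exists C t0, 0 < C /\ forall t s, t0 <= t ->
  `|s - t| <= dl t -> F s <= F t + G t * (s - t) + C.
Proof.
have [c [C [c0 C0 /(_ 1 ltr01)[t0 ht0]]]] := rg_bounds rg.
exists C, t0; split => // t s /ht0 {}ht0 st.
have d0 := rg_dl rg t.
suff : (F s - F t - G t * (s - t)) <= C / dl t ^+ 2 * `|s - t| ^+ 2.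
  have : C / dl t ^+ 2 * `|s - t| ^+ 2 <= C; last lra.
  rewrite mulrAC ler_pdivrMr ?exprn_gt0// (ler_pM2l C0).
  have := normr_ge0 (s - t); nra.
rewrite real_normK ?num_real//; move: st; rewrite ler_norml => /andP[st1 st2].
have [st|ts|->] := ltgtP s t; last by rewrite !subrr mulr0 expr0n/= mulr0.
- have [x [sx xt ->]] : exists x, [/\ s < x, x < t & F s - F t = G x * (s - t)].
    have [x [sx xt FE]] := MVT_total (rg_dF rg) st.
    by exists x; split => //; rewrite -[LHS]opprB FE; ring.
  have [y [xy yt GE]] := MVT_total (rg_dG rg) xt.
  have [|_ Hy] := ht0 y; first by rewrite mul1r ler_norml; lra.
  have Hy0 := rg_H rg y.
  set K := C / _ in Hy *.
  have h : G t - G x <= K * (t - s) by rewrite GE; nra.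
  nra.
- have [x [tx xs ->]] := MVT_total (rg_dF rg) ts.
  have [y [ty yx GE]] := MVT_total (rg_dG rg) tx.
  have [|_ Hy] := ht0 y; first by rewrite mul1r ler_norml; lra.
  have Hy0 := rg_H rg y.
  set K := C / _ in Hy *.
  have h : G x - G t <= K * (s - t) by rewrite GE; nra.
  nra.
Qed.

Lemma slope_step : exists2 c, 0 < c & forall X, 0 < X -> exists t0,
  forall t u v,
  t0 <= t -> `|u - t| <= X * dl t -> `|v - t| <= X * dl t -> u <= v ->
  c / dl t ^+ 2 * (v - u) <= G v - G u.
Proof.
have [c [C [c0 C0 hX]]] := rg_bounds rg.
exists c => // X /hX[t0 ht0]; exists t0 => t u v /ht0 {}ht0 ut vt.
rewrite le_eqVlt => /predU1P[->|uv]; first by rewrite !subrr mulr0.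
have [y [uy yv GE]] := MVT_total (rg_dG rg) uv.
have [|Hy _] := ht0 y.
  move: ut vt; rewrite !ler_norml => /andP[? ?] /andP[? ?]; lra.
by rewrite GE ler_wpM2r// subr_ge0 ltW.
Qed.

(** The slope at the midpoint of the step differs from both end slopes by at least [c / (2 * dl t)].
    Following the tangent at the midpoint over the second half step gains [c / 4], in either
    direction. *)
Lemma tangent_gap : exists2 c, 0 < c & exists t0, forall t, t0 <= t ->
  F t + G t * dl t + c <= F (t + dl t) /\
  F (t + dl t) - G (t + dl t) * dl t + c <= F t.
Proof.
have [c c0 /(_ 1 ltr01)[t0 ht0]] := slope_step.
exists (c / 4); first by rewrite divr_gt0.
exists t0 => t /ht0 {}ht0; have d0 := rg_dl rg t.
set d := dl t in d0 ht0 *.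
have h1 := ht0 t (t + d / 2); have h2 := ht0 (t + d / 2) (t + d).
have cE : c / d ^+ 2 * (d / 2) * (d / 2) = c / 4 by field; rewrite gt_eqF.
have {}h1 : c / d ^+ 2 * (t + d / 2 - t) <= G (t + d / 2) - G t.
  by apply: h1; rewrite ?ler_norml; lra.
have {}h2 : c / d ^+ 2 * (t + d - (t + d / 2)) <= G (t + d) - G (t + d / 2).
  by apply: h2; rewrite ?ler_norml; lra.
have E1 : t + d / 2 - t = d / 2 by ring.
have E2 : t + d - (t + d / 2) = d / 2 by field.
rewrite E1 in h1; rewrite E2 in h2.
set K := c / d ^+ 2 * (d / 2) in cE h1 h2.
have := tangent_below (t + d / 2) (t + d); have := tangent_below t (t + d / 2).
have := tangent_below (t + d / 2) t; have := tangent_below (t + d) (t + d / 2).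
rewrite E1 E2.
have -> : t + d / 2 - (t + d) = - (d / 2) by field.
have -> : t - (t + d / 2) = - (d / 2) by ring.
move=> *; split; nra.
Qed.

(* Beyond distance [k dl t / c] from [t], the slope of [F] differs from [G t]
   by at least [k / dl t]. *)
Lemma tangent_linear_gap k : 0 < k -> exists C t0, 0 < C /\ forall t s, t0 <= t ->
  F t + G t * (s - t) + k / dl t * `|s - t| - C <= F s.
Proof.
move=> k0; have [c c0 hX] := slope_step.
pose X := k / c; have X0 : 0 < X by rewrite divr_gt0.
have [t0 ht0] := hX X X0.
(* Within distance [X * dl t] the linear term is at most [k * X] and the constant absorbs it;
   farther out the tangent at the edge of the window takes over. *)
exists (k * X), t0; split; first by rewrite mulr_gt0.
move=> t s /ht0 {}ht0; have d0 := rg_dl rg t.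
have dn : dl t != 0 by rewrite gt_eqF.
have Xd0 : 0 < X * dl t by rewrite mulr_gt0.
have slopeE : c / dl t ^+ 2 * (X * dl t) = k / dl t.
  by rewrite /X; field; rewrite dn gt_eqF.
have kXE : k / dl t * (X * dl t) = k * X by field.
have kd0 : 0 < k / dl t by rewrite divr_gt0.
have tb := tangent_below t s.
have [near|] := lerP `|s - t| (X * dl t).
  have : k / dl t * `|s - t| <= k * X by rewrite -kXE ler_wpM2l// ltW.
  lra.
rewrite ltr_normr => /orP[far|far].
  rewrite gtr0_norm; last lra.
  have := ht0 t (t + X * dl t); rewrite subrr normr0 [t + _ - t]addrC addKr.
  rewrite gtr0_norm// lexx slopeE => /(_ (ltW _) _ _) hs.
  have {}hs : k / dl t <= G (t + X * dl t) - G t by apply: hs => //; lra.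
  have := tangent_below (t + X * dl t) s; have := tangent_below t (t + X * dl t).
  rewrite [t + _ - t]addrC addKr => h1 h2; rewrite -kXE; nra.
rewrite ltr0_norm; last lra.
have := ht0 (t - X * dl t) t; rewrite subrr normr0 [t - _ - t]addrC addKr normrN.
rewrite opprB addrCA subrr addr0 gtr0_norm// lexx slopeE => hs.
have {}hs : k / dl t <= G t - G (t - X * dl t) by apply: hs => //; lra.
have := tangent_below (t - X * dl t) s; have := tangent_below t (t - X * dl t).
rewrite [t - _ - t]addrC addKr => h1 h2; rewrite -kXE; nra.
Qed.

Lemma dl_small e : 0 < e -> exists t0, forall t, t0 <= t -> dl t <= e.
Proof.
move=> /(rg_tau rg)[t0 ht0]; exists (Num.max 0 t0) => t.
rewrite ge_max => /andP[t_ge0 /ht0].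
apply: le_trans; rewrite ler_peMl ?(ltW (rg_dl rg _))//.
by rewrite -expR0 ler_expR.
Qed.

(** The last step before [t] alone raises the slope by [c / dl t], which tends to infinity, and
    before it the slope is at least [G 0]. *)
Lemma slope_large M : exists t0, forall t, t0 <= t -> M <= G t.
Proof.
have [c c0 /(_ 1 ltr01)[t0 ht0]] := slope_step.
have M0 : 0 < `|M - G 0| + 1 by rewrite ltr_wpDl.
have [t1 ht1] := dl_small (e := c / (`|M - G 0| + 1)) (divr_gt0 c0 M0).
have [t2 ht2] := dl_small ltr01.
exists (Num.max (Num.max t0 t1) (Num.max t2 1)) => t.
rewrite !ge_max => /andP[/andP[/ht0 {}ht0 /ht1 d1] /andP[/ht2 d2 t_ge1]].
have d0 := rg_dl rg t.
have := ht0 (t - dl t) t; rewrite subrr normr0 [t - _ - t]addrC addKr normrN.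
rewrite opprB addrCA subrr addr0 gtr0_norm// mul1r lexx => hs.
have {}hs : c / dl t ^+ 2 * dl t <= G t - G (t - dl t) by apply: hs => //; lra.
have G0 : G 0 <= G (t - dl t) by apply: slope_le; lra.
have cE : c / dl t ^+ 2 * dl t = c / dl t by field; rewrite gt_eqF.
have : `|M - G 0| + 1 <= c / dl t by rewrite ler_pdivlMr// mulrC -ler_pdivlMr.
have := ler_norm (M - G 0); lra.
Qed.

End RegularGrowth.

(** * Entire sums of polynomials with nonnegative coefficients *)

Section ComplexSequences.
Variable R : realType.

Definition cvgC (a : nat -> R[i]) (l : R[i]) : Prop :=
  ((fun n => complex.Re (a n)) @ \oo --> complex.Re l) /\
  ((fun n => complex.Im (a n)) @ \oo --> complex.Im l).

Lemma cvgC_cmod a l : cvgC a l -> (fun n => cmod (a n)) @ \oo --> cmod l.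
Proof.
move=> [ra ia].
have cE z : cmod z = Num.sqrt (complex.Re z ^+ 2 + complex.Im z ^+ 2) by case: z.
rewrite cE; under eq_fun do rewrite cE.
apply: continuous_cvg; first exact: sqrt_continuous.
by apply: cvgD; rewrite expr2; under eq_fun do rewrite expr2; exact: cvgM.
Qed.

Lemma cvgCB a b l k : cvgC a l -> cvgC b k -> cvgC (fun n => a n - b n) (l - k).
Proof.
have reB (z w : R[i]) : complex.Re (z - w) = complex.Re z - complex.Re w.
  by case: z w => ? ? [].
have imB (z w : R[i]) : complex.Im (z - w) = complex.Im z - complex.Im w.
  by case: z w => ? ? [].
move=> [ra ia] [rb ib]; split.
  by rewrite reB; under eq_fun do rewrite reB; exact: cvgB.
by rewrite imB; under eq_fun do rewrite imB; exact: cvgB.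
Qed.

Lemma cvgC_cst l : cvgC (fun=> l) l.
Proof. by split; exact: cvg_cst. Qed.

Lemma cvgCZ a l (h : R[i]) : cvgC a l -> cvgC (fun n => h * a n) (h * l).
Proof.
have reM (w : R[i]) : complex.Re (h * w) =
    complex.Re h * complex.Re w - complex.Im h * complex.Im w.
  by clear; case: h w => ? ? [].
have imM (w : R[i]) : complex.Im (h * w) =
    complex.Re h * complex.Im w + complex.Im h * complex.Re w.
  by clear; case: h w => ? ? [].
move=> [ra ia]; split.
  by rewrite reM; under eq_fun do rewrite reM; apply: cvgB; apply: cvgMl_tmp.
by rewrite imM; under eq_fun do rewrite imM; apply: cvgD; apply: cvgMl_tmp.
Qed.

Lemma cvgC_cmod_le a l B N : cvgC a l ->
  (forall n, (N <= n)%N -> cmod (a n) <= B) -> cmod l <= B.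
Proof.
by move=> /cvgC_cmod cl aB; apply: (cvgr_to_le cl); exists N.
Qed.

Definition limC (a : nat -> R[i]) : R[i] :=
  Complex (limn (fun n => complex.Re (a n))) (limn (fun n => complex.Im (a n))).

Lemma cvg_sum_dominated (u v : nat -> R) (B : R) :
  (forall j, `|u j| <= v j) -> (forall n, \sum_(j < n) v j <= B) ->
  cvgn (fun n => \sum_(j < n) u j).
Proof.
move=> uv vB.
have seriesE (w : nat -> R) : (fun n => \sum_(j < n) w j) = series w.
  by apply/funext => n; rewrite /series /= big_mkord.
have v0 j : 0 <= v j := le_trans (normr_ge0 _) (uv j).
rewrite seriesE; apply: normed_cvg.
apply: (@series_le_cvg _ _ v) => [n|n|n|]; [exact: normr_ge0|exact: v0|exact: uv|].
apply: nondecreasing_is_cvgn.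
  by apply/nondecreasing_seqP => n; rewrite /series /= big_nat_recr//= lerDl.
by exists B => _ [n _ <-]; rewrite -seriesE.
Qed.

Lemma cvgC_sum_dominated (a : nat -> R[i]) (v : nat -> R) (B : R) :
  (forall j, cmod (a j) <= v j) -> (forall n, \sum_(j < n) v j <= B) ->
  cvgC (fun n => \sum_(j < n) a j) (limC (fun n => \sum_(j < n) a j)).
Proof.
move=> av vB.
split => /=.
- have -> : (fun n => complex.Re (\sum_(j < n) a j)) =
     (fun n => \sum_(j < n) complex.Re (a j)) by apply/funext => n; rewrite Re_sum.
  have cvgS : cvgn (fun n => \sum_(j < n) complex.Re (a j)).
    apply: (@cvg_sum_dominated (fun j => complex.Re (a j)) v B) => // j.
    exact: le_trans (cmod_ge_Re _) (av j).
  exact: cvgS.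
- have -> : (fun n => complex.Im (\sum_(j < n) a j)) =
     (fun n => \sum_(j < n) complex.Im (a j)) by apply/funext => n; rewrite Im_sum.
  have cvgS : cvgn (fun n => \sum_(j < n) complex.Im (a j)).
    apply: (@cvg_sum_dominated (fun j => complex.Im (a j)) v B) => // j.
    exact: le_trans (cmod_ge_Im _) (av j).
  exact: cvgS.
Qed.

(** Dividing the first-order expansion by [h] leaves an error of at most [|h| * B], so [l] is the
    complex derivative. *)
Lemma derivable_quadratic (f : R[i] -> R[i]) (z l : R[i]) (B : R) :
  (forall h, cmod h <= 1 -> cmod (f (z + h) - f z - h * l) <= cmod h ^+ 2 * B) ->
  @derivable R[i] R[i]^o R[i]^o f z 1.
Proof.
move=> fB; apply/cvg_ex; exists (l : R[i]^o).
(* A positive element of [R[i]] has zero imaginary and positive real part, so the radius is taken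
   from the real part of [e]. *)
apply/cvgrPdist_lt => e; rewrite ltcE /= => /andP[/eqP ime ree].
have B1 : 0 < `|B| + 1 by rewrite ltr_wpDl.
pose d := Num.min 1 (complex.Re e / (`|B| + 1)).
have d0 : 0 < d by rewrite lt_min ltr01 divr_gt0.
exists (real_complex R d) => /=; first by rewrite ltcR.
move=> h /=; rewrite sub0r normrN normCE ltcR lt_min => /andP[h1 he] h0.
have hn0 : cmod h != 0 by apply/eqP => /cmod_eq0/eqP; apply/negP.
have hp : 0 < cmod h by rewrite lt_neqAle eq_sym hn0 cmod_ge0.
have {}fB := fB h (ltW h1).
rewrite normCE ltcE /= ime eqxx /=.
have -> : l - h^-1 *: (f (h *: (1 : R[i]) + z) - f z) =
    - (h^-1 * (f (z + h) - f z - h * l)).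
  have -> : h *: (1 : R[i]) + z = z + h.
    by rewrite addrC; congr (_ + _); rewrite -[RHS]mulr1.
  have -> : h^-1 *: (f (z + h) - f z) = h^-1 * (f (z + h) - f z) by [].
  by field.
rewrite cmodN cmodM cmodV mulrC ltr_pdivrMr//.
apply: le_lt_trans fB _; rewrite expr2 mulrC mulrA ltr_pM2r//.
move: he; rewrite ltr_pdivlMr//; have := ler_norm B; nra.
Qed.

End ComplexSequences.

Section PolySeries.
Variables (R : realType) (P : nat -> {poly R}).
Hypothesis P0 : forall j, nneg_poly (P j).
Hypothesis PB : forall r : R, 0 <= r ->
  exists B : R, forall n, \sum_(j < n) (P j).[r] <= B.

Definition psum n : {poly R} := \sum_(j < n) P j.
Definition fsum (z : R[i]) : R[i] := limC (fun n => pev (psum n) z).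

Lemma psumE z : (fun n => pev (psum n) z) = (fun n => \sum_(j < n) pev (P j) z).
Proof. by apply/funext => n; rewrite /psum pev_sum. Qed.

Lemma fsum_cvg z : cvgC (fun n => pev (psum n) z) (fsum z).
Proof.
have [B hB] := PB (cmod_ge0 z).
rewrite /fsum psumE.
exact: (@cvgC_sum_dominated _ (fun j => pev (P j) z) (fun j => (P j).[cmod z]) B
  (fun j => cmod_pev z (P0 j)) hB).
Qed.

Lemma fsum_tail z N (B : R) :
  (forall n, (N <= n)%N -> \sum_(N <= j < n) (P j).[cmod z] <= B) ->
  cmod (fsum z - pev (psum N) z) <= B.
Proof.
move=> hB; apply: (@cvgC_cmod_le _ _ _ _ N (cvgCB (fsum_cvg z) (cvgC_cst _))).
move=> n Nn; apply: le_trans (hB n Nn).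
have -> : pev (psum n) z - pev (psum N) z = \sum_(N <= j < n) pev (P j) z.
  rewrite /psum !pev_sum -!(big_mkord xpredT (fun j => pev (P j) z)).
  by rewrite (big_cat_nat (leq0n N) Nn)/= [X in X - _]addrC addrK.
by apply: le_trans (cmod_sum _ _ _) _; apply: ler_sum => j _; exact: cmod_pev.
Qed.

(** The quadratic remainders of the partial sums are at most [|h|^2 * B], where [B] bounds the sums
    at [|z| + 1] for every number of terms; the estimate survives the limit. *)
Lemma entire_fsum : entire fsum.
Proof.
move=> z.
have [B hB] := PB (addr_ge0 (cmod_ge0 z) ler01).
pose a n := \sum_(j < n) pev (P j)^`N(1) z.
have al : cvgC a (limC a).
  exact: (@cvgC_sum_dominated _ (fun j => pev (P j)^`N(1) z)
    (fun j => (P j).[cmod z + 1]) B (fun j => cmod_pev_deriv z (P0 j)) hB).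
apply: (@derivable_quadratic _ _ _ (limC a) B) => h h1.
have := cvgCB (cvgCB (fsum_cvg (z + h)) (fsum_cvg z)) (cvgCZ h al).
move=> /(@cvgC_cmod_le _ _ _ (cmod h ^+ 2 * B) 0); apply => n _.
rewrite /psum !pev_sum /a mulr_sumr -!sumrB.
apply: le_trans (cmod_sum _ _ _) _.
apply: (@le_trans _ _ (\sum_(j < n) cmod h ^+ 2 * (P j).[cmod z + 1])).
  by apply: ler_sum => j _; exact: cmod_pev_diff2.
by rewrite -mulr_sumr ler_wpM2l ?exprn_ge0 ?cmod_ge0.
Qed.

End PolySeries.

(** * Weighted integrals over the plane *)

Local Notation plane R := (measurableTypeR R * measurableTypeR R)%type.
Local Notation box r := (`[- r, r] `*` `[- r, r] : set (plane _)).

Section PlaneMeasurability.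
Variable R : realType.

Lemma measurable_Re_Im_exp n :
  measurable_fun setT (fun w : plane R => complex.Re (toC w ^+ n)) /\
  measurable_fun setT (fun w : plane R => complex.Im (toC w ^+ n)).
Proof.
elim: n => [|n [ihr ihi]].
  by split; under eq_fun do rewrite expr0; exact: measurable_cst.
have reE (w : plane R) : complex.Re (toC w ^+ n.+1) =
    w.1 * complex.Re (toC w ^+ n) - w.2 * complex.Im (toC w ^+ n).
  by rewrite exprS; case: (toC w ^+ n).
have imE (w : plane R) : complex.Im (toC w ^+ n.+1) =
    w.1 * complex.Im (toC w ^+ n) + w.2 * complex.Re (toC w ^+ n).
  by rewrite exprS; case: (toC w ^+ n).
split.
- under eq_fun do rewrite reE; apply: measurable_funB.
  + by apply: measurable_funM => //; exact: measurable_fst.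
  + by apply: measurable_funM => //; exact: measurable_snd.
- under eq_fun do rewrite imE; apply: measurable_funD.
  + by apply: measurable_funM => //; exact: measurable_fst.
  + by apply: measurable_funM => //; exact: measurable_snd.
Qed.

Lemma measurable_cmod_ReIm (f : plane R -> R[i]) :
  measurable_fun setT (fun w => complex.Re (f w)) ->
  measurable_fun setT (fun w => complex.Im (f w)) ->
  measurable_fun setT (fun w => cmod (f w)).
Proof.
move=> mr mi.
have cE z : cmod z = Num.sqrt (complex.Re z ^+ 2 + complex.Im z ^+ 2) :> R by case: z.
under eq_fun do rewrite cE.
have ms := continuous_measurable_fun (@sqrt_continuous R).
apply: (measurableT_comp ms).
by apply: measurable_funD; apply: measurable_funX.
Qed.

Lemma measurable_cmod_toC : measurable_fun setT (fun w : plane R => cmod (toC w)).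
Proof.
have [] := measurable_Re_Im_exp 1.
by under eq_fun do rewrite expr1; move=> ?; under eq_fun do rewrite expr1; exact: measurable_cmod_ReIm.
Qed.

Lemma measurable_cmod_pev (P : {poly R}) :
  measurable_fun setT (fun w : plane R => cmod (pev P (toC w))).
Proof.
have reE (w : plane R) : complex.Re (pev P (toC w)) =
    \sum_(i < size P) P`_i * complex.Re (toC w ^+ i).
  rewrite pevE Re_sum; apply: eq_bigr => i _.
  by case: (_ ^+ _) => ? ? /=; rewrite mul0r subr0.
have imE (w : plane R) : complex.Im (pev P (toC w)) =
    \sum_(i < size P) P`_i * complex.Im (toC w ^+ i).
  rewrite pevE Im_sum; apply: eq_bigr => i _.
  by case: (_ ^+ _) => ? ? /=; rewrite mul0r addr0.
apply: measurable_cmod_ReIm.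
- under eq_fun do rewrite reE; apply: measurable_sum => i; apply: measurable_funM => //.
  by have [] := measurable_Re_Im_exp i.
- under eq_fun do rewrite imE; apply: measurable_sum => i; apply: measurable_funM => //.
  by have [] := measurable_Re_Im_exp i.
Qed.

Lemma area_rectangle (a b c d : R) : a <= b -> c <= d ->
  area R (`[a, b] `*` `[c, d]) = ((b - a) * (d - c))%:E.
Proof.
move=> ab cd.
transitivity (@lebesgue_measure R `[a, b] * @lebesgue_measure R `[c, d])%E.
  exact: product_measure1E.
rewrite !lebesgue_measure_itv/= !lte_fin.
rewrite EFinM; congr (_ * _)%E.
- by case: ltgtP ab => // -> _; rewrite subrr.
- by case: ltgtP cd => // -> _; rewrite subrr.
Qed.

Lemma rectangle_sub_box (a b c d r : R) :
  - r <= a -> b <= r -> - r <= c -> d <= r ->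
  (`[a, b] `*` `[c, d] : set (plane R)) `<=` `[- r, r] `*` `[- r, r].
Proof.
move=> ra br rc dr [x y] /= []; rewrite !in_itv/= => /andP[x1 x2] /andP[y1 y2].
by split; apply/andP; split; lra.
Qed.

End PlaneMeasurability.

(** * Powers of sums, for exponents below and above 1 alike *)

Section PowerInequalities.
Variable R : realType.
Implicit Types (p q x y : R).

Lemma powR_mono p x y : 0 <= p -> 0 <= x -> x <= y -> x `^ p <= y `^ p.
Proof.
by move=> p0 x0 xy; apply: ge0_ler_powR; rewrite ?nnegrE// (le_trans x0).
Qed.

Lemma powR_add_le p x y : 0 <= p -> 0 <= x -> 0 <= y ->
  (x + y) `^ p <= (2 * x) `^ p + (2 * y) `^ p.
Proof.
move=> p0 x0 y0; have [xy|/ltW yx] := leP x y.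
  apply: (@le_trans _ _ ((2 * y) `^ p)); last by rewrite lerDr powR_ge0.
  by apply: powR_mono => //; lra.
apply: (@le_trans _ _ ((2 * x) `^ p)); last by rewrite lerDl powR_ge0.
by apply: powR_mono => //; lra.
Qed.

Lemma powR_add3_le p (x y z : R) : 0 <= p -> 0 <= x -> 0 <= y -> 0 <= z ->
  (x + y + z) `^ p <= 3 `^ p * (x `^ p + y `^ p + z `^ p).
Proof.
move=> p0 x0 y0 z0.
have [m [m0 xm ym zm mp]] : exists m, [/\ 0 <= m, x <= m, y <= m, z <= m &
    m `^ p <= x `^ p + y `^ p + z `^ p].
  have := powR_ge0 x p; have := powR_ge0 y p; have := powR_ge0 z p.
  have [xy|yx] := leP x y; have [yz|zy] := leP y z; have [xz|zx] := leP x z => *;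
  first [by exists x; split => //; lra | by exists y; split => //; lra |
         by exists z; split => //; lra].
apply: (@le_trans _ _ ((3 * m) `^ p)); first by apply: powR_mono => //; lra.
by rewrite powRM// ler_wpM2l ?powR_ge0.
Qed.

(** Each use of the two-term inequality splits off the first term and doubles the rest, whence the
    weights [2 ^+ j.+1]. They are harmless because the summands will be chosen as small as
    needed. *)
Lemma powR_sum_le p n (x : nat -> R) : 0 < p -> (forall j, 0 <= x j) ->
  (\sum_(j < n) x j) `^ p <= \sum_(j < n) (2 ^+ j.+1 * x j) `^ p.
Proof.
move=> p0; elim: n x => [|n ih] x x0.
  by rewrite !big_ord0 powR0// gt_eqF.
rewrite !big_ord_recl /=.
apply: le_trans (powR_add_le (ltW p0) (x0 _) _) _; first by rewrite sumr_ge0.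
rewrite expr1 lerD2l mulr_sumr.
apply: le_trans (ih (fun j => 2 * x j.+1) _) _; first by move=> j; rewrite mulr_ge0.
by rewrite ler_sum// => j _; rewrite mulrA -exprSr.
Qed.

Lemma cvg_powR p (u : nat -> R) (l : R) : 0 < p -> (forall n, 0 <= u n) ->
  u n @[n --> \oo] --> l -> (u n) `^ p @[n --> \oo] --> l `^ p.
Proof.
move=> p0 u0 ul.
have l0 : 0 <= l by apply: (cvgr_to_ge ul); near=> n.
have [l_gt0|] := ltP 0 l; last first.
  move=> l_le0; have lE : l = 0 by apply/eqP; rewrite eq_le l_le0.
  rewrite lE powR0 ?gt_eqF//; apply/cvgrPdist_le => e e0.
  move/cvgrPdist_le : ul => /(_ (e `^ p^-1)); rewrite powR_gt0// => /(_ isT).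
  apply: filterS => n; rewrite lE !sub0r !normrN !ger0_norm ?powR_ge0// => ue.
  apply: le_trans (powR_mono (ltW p0) (u0 n) ue) _.
  by rewrite -powRrM mulVf ?gt_eqF// powRr1// ltW.
have powE x : 0 < x -> x `^ p = expR (p * ln x).
  by move=> x0; rewrite /powR gt_eqF.
rewrite powE//.
have cvgE : expR (p * ln (u n)) @[n --> \oo] --> expR (p * ln l).
  apply: continuous_cvg; first exact: continuous_expR.
  apply: cvgMl_tmp; apply: continuous_cvg => //; exact: continuous_ln.
apply: cvg_trans cvgE; apply: near_eq_cvg.
move/cvgrPdist_lt : ul => /(_ l l_gt0); apply: filterS => n.
by rewrite ltr_norml => /andP[_ ?]; rewrite powE//; lra.
Unshelve. all: by end_near. Qed.

End PowerInequalities.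

(** * Integrals of powers of the weighted modulus *)

Section FockIntegrals.
Variables (R : realType) (phi : R -> R).
Hypothesis phi_ge0 : forall r, 0 <= r -> 0 <= phi r.
Hypothesis mphi : measurable_fun setT (fun w : plane R => phi (cmod (toC w))).
Implicit Types (f g : R[i] -> R[i]) (p q : R).

Definition wmod f (w : plane R) : R := cmod (f (toC w)) * expR (- phi (cmod (toC w))).

Definition fock_int (D : set (plane R)) p f : \bar R :=
  (\int[area R]_(w in D) (wmod f w `^ p)%:E)%E.

Lemma wmod_ge0 f w : 0 <= wmod f w.
Proof. by rewrite mulr_ge0 ?cmod_ge0 ?expR_ge0. Qed.

Lemma fock_norm_powE p f : fock_norm_pow phi p f = fock_int setT p f.
Proof.
rewrite /fock_norm_pow /fock_int; apply: eq_integral => w _; congr EFin.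
by rewrite powRM ?cmod_ge0 ?expR_ge0// -expRM mulrC mulNr -mulrN mulrC [p * _]mulrC.
Qed.

Definition cmeasurable f := measurable_fun setT (fun w : plane R => cmod (f (toC w))).

Lemma measurable_wmod f : cmeasurable f -> measurable_fun setT (wmod f).
Proof.
move=> mf; apply: measurable_funM => //.
apply: measurableT_comp; first exact: measurable_expR.
exact: measurableT_comp.
Qed.

Lemma measurable_wmod_pow p f D : cmeasurable f ->
  measurable_fun D (fun w => (wmod f w `^ p)%:E).
Proof.
move=> mf; apply: (@measurable_funS _ _ _ _ setT) => //.
apply: measurableT_comp => //.
exact: (measurableT_comp (measurable_powR p) (measurable_wmod mf)).
Qed.

Lemma fock_int_ge0 D p f : (0 <= fock_int D p f)%E.
Proof. by apply: integral_ge0 => w _; rewrite lee_fin powR_ge0. Qed.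

Lemma fock_int_subset D p f : measurable D -> cmeasurable f ->
  (fock_int D p f <= fock_int setT p f)%E.
Proof.
move=> mD mf; apply: ge0_subset_integral => //.
- exact: measurable_wmod_pow.
- by move=> w _; rewrite lee_fin powR_ge0.
Qed.

Lemma cmeasurable_pev (P : {poly R}) : cmeasurable (pev P).
Proof. exact: measurable_cmod_pev. Qed.

Lemma wmod_pevZ (c : R) (P : {poly R}) w : 0 <= c ->
  wmod (pev (c *: P)) w = c * wmod (pev P) w.
Proof. by move=> c0; rewrite /wmod pevZ cmodM cmod_real ger0_norm// mulrA. Qed.

Lemma fock_intZ D p (c : R) (P : {poly R}) : measurable D -> 0 <= c ->
  fock_int D p (pev (c *: P)) = ((c `^ p)%:E * fock_int D p (pev P))%E.
Proof.
move=> mD c0; have mP := measurable_wmod_pow p (D := D) (cmeasurable_pev P).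
rewrite /fock_int -(ge0_integralZl _ mD mP) ?lee_fin ?powR_ge0//; last first.
  by move=> w _; rewrite lee_fin powR_ge0.
by apply: eq_integral => w _; rewrite wmod_pevZ// powRM ?wmod_ge0// EFinM.
Qed.

Lemma fock_int_add p (P Q : {poly R}) : 0 <= p ->
  (fock_int setT p (pev (P + Q)) <=
   (2 `^ p)%:E * (fock_int setT p (pev P) + fock_int setT p (pev Q)))%E.
Proof.
move=> p0; have mP (S : {poly R}) := measurable_wmod_pow p (D := setT) (cmeasurable_pev S).
have pos (S : {poly R}) (w : plane R) : setT w -> (0 <= (wmod (pev S) w `^ p)%:E)%E.
  by rewrite lee_fin powR_ge0.
rewrite /fock_int -ge0_integralD//; [|exact: pos|exact: pos].
have mPQ := emeasurable_funD (mP P) (mP Q).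
rewrite -(ge0_integralZl _ _ mPQ) ?lee_fin ?powR_ge0//; last first.
  by move=> w wT; apply: adde_ge0; exact: pos.
apply: ge0_le_integral => //; first exact: pos.
  by apply: measurable_funeM; exact: emeasurable_funD.
move=> w _; rewrite -EFinD -EFinM lee_fin mulrDr -!powRM ?wmod_ge0//.
apply: le_trans (powR_add_le p0 (wmod_ge0 _ _) (wmod_ge0 _ _)).
apply: powR_mono; rewrite ?wmod_ge0// /wmod -mulrDl ler_wpM2r ?expR_ge0//.
by rewrite pevD cmodD.
Qed.

End FockIntegrals.

(** * Gliding hump *)

Section GlidingHump.
Variables (R : realType) (phi : R -> R).
Hypothesis phi_ge0 : forall r, 0 <= r -> 0 <= phi r.
Hypothesis mphi : measurable_fun setT (fun w : plane R => phi (cmod (toC w))).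
Variables p q : R.
Hypotheses (p0 : 0 < p) (q0 : 0 < q).

Local Notation I := (fock_int phi).

(** As the coefficients are nonnegative, [P.[r]] controls [P] on the whole disc of radius [r].
    Largeness is required on a bounded box, so that later summands, small on a disc around it,
    cannot destroy it. *)
Definition humps : Prop := forall e r M : R, 0 < e -> 0 <= r -> exists P rho,
  [/\ nneg_poly P, P.[r] <= e, (I setT p (pev P) <= e%:E)%E,
      (I setT q (pev P) < +oo)%E & (M%:E <= I (box rho) q (pev P))%E].

Hypothesis H : humps.

(* The damping factor makes the total contribution of the later humps to the
   integral over the current box at most 1. *)
Definition damping (r : R) : R := (1 + 4 * r ^+ 2)^-1 `^ q^-1.

Lemma damping_gt0 r : 0 < damping r.
Proof. by rewrite powR_gt0// invr_gt0; have := sqr_ge0 r; lra. Qed.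

Lemma damping_pow r : damping r `^ q * (4 * r ^+ 2) <= 1.
Proof.
rewrite /damping -powRrM mulVf ?gt_eqF// powRr1; last first.
  by rewrite invr_ge0; have := sqr_ge0 r; lra.
have h : 0 <= r ^+ 2 by exact: sqr_ge0.
by rewrite mulrC ler_pdivrMr; lra.
Qed.

Lemma damping_le r s : 0 <= r -> r <= s -> damping s <= damping r.
Proof.
move=> r0 rs; apply: powR_mono; first by rewrite invr_ge0 ltW.
  by rewrite invr_ge0; have := sqr_ge0 s; lra.
rewrite lef_pV2 ?posrE; nra.
Qed.

Let next_spec (s : nat * ({poly R} * R)) (o : {poly R} * R) : Prop :=
  0 <= s.2.2 -> (I setT q (pev s.2.1) < +oo)%E ->
  [/\ nneg_poly o.1 /\ s.2.2 <= o.2,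
     o.1.[2 * s.2.2 + s.1%:R] <= 2^-1 ^+ s.1.+1 * damping s.2.2,
     (((2 ^+ s.1.+1) `^ p)%:E * I setT p (pev o.1) <= (2^-1 ^+ s.1.+1)%:E)%E,
     (I setT q (pev o.1) < +oo)%E &
     ((3 `^ q)%:E * (s.1%:R%:E + I setT q (pev s.2.1) + 1) <= I (box o.2) q (pev o.1))%E].

Let next_exists s : exists o, next_spec s o.
Proof.
have [valid|] := pselect (0 <= s.2.2 /\ (I setT q (pev s.2.1) < +oo)%E); last first.
  (* On an invalid state the specification holds vacuously, so any default value serves. *)
  by move=> nvalid; exists (0, 0) => ? ?; case: nvalid.
move: s valid => [n [g r]] /= [r0 gfin].
pose e := Num.min (2^-1 ^+ n.+1 * damping r) (2^-1 ^+ n.+1 / (2 ^+ n.+1) `^ p).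
have e0 : 0 < e.
  have half0 : 0 < (2^-1 : R) ^+ n.+1 by rewrite exprn_gt0 ?invr_gt0.
  rewrite lt_min; apply/andP; split; first by rewrite mulr_gt0 ?damping_gt0.
  by rewrite divr_gt0// powR_gt0 ?exprn_gt0.
have gnum : I setT q (pev g) \is a fin_num by rewrite ge0_fin_numE ?fock_int_ge0.
pose M := 3 `^ q * (n%:R + fine (I setT q (pev g)) + 1).
have r2 : 0 <= 2 * r + n%:R by rewrite addr_ge0 ?mulr_ge0.
have [P [rho [Pnn Pr Pp Pq PM]]] := H M e0 r2.
exists (P, Num.max r rho) => _ _ /=; split => //.
- by split => //; rewrite le_max lexx.
- by apply: le_trans Pr _; rewrite ge_min lexx.
- have pw0 : 0 < (2 ^+ n.+1 : R) `^ p by rewrite powR_gt0 ?exprn_gt0.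
  apply: (@le_trans _ _ (((2 ^+ n.+1) `^ p)%:E * e%:E)%E).
    by rewrite lee_pmul2l// lte_fin.
  by rewrite -EFinM lee_fin mulrC -ler_pdivlMr// ge_min lexx orbT.
- apply: (@le_trans _ _ (I (box rho) q (pev P))); last first.
    apply: ge0_subset_integral.
    + by apply: measurableX.
    + by apply: measurableX.
    + by apply: measurable_wmod_pow => //; exact: cmeasurable_pev.
    + by move=> w _; rewrite lee_fin powR_ge0.
    + have rho_le : rho <= Num.max r rho by rewrite le_max lexx orbT.
      by apply: rectangle_sub_box; rewrite ?lerN2.
  by move: PM; rewrite /M !EFinM !EFinD fineK.
Qed.

Let next_sig : {f | forall s, next_spec s (f s)}.
Proof. by have [f fP] := choice next_exists; exists f. Qed.

Let next := sval next_sig.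

Let nextP s : next_spec s (next s).
Proof. exact: (svalP next_sig). Qed.

Fixpoint hump_state (n : nat) : {poly R} * R :=
  if n is m.+1 then
    let s := hump_state m in let o := next (m, s) in (s.1 + o.1, o.2)
  else (0, 0).

Let hump n := (next (n, hump_state n)).1.
Local Notation radius n := (hump_state n).2.

Lemma psum_hump n : psum hump n = (hump_state n).1.
Proof.
by elim: n => [|n ih]; rewrite /psum ?big_ord0// big_ord_recr/= -ih.
Qed.

Lemma hump_state_valid n :
  0 <= radius n /\ (I setT q (pev (hump_state n).1) < +oo)%E.
Proof.
elim: n => [|n [r0 gfin]] /=.
  split => //; rewrite /fock_int integral0_eq ?ltry// => w _.
  by rewrite /wmod pev0 cmod0 mul0r powR0// gt_eqF.
have [[_ rr] _ _ Pfin _] := nextP (s := (n, hump_state n)) r0 gfin.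
split; first exact: le_trans r0 rr.
apply: le_lt_trans (fock_int_add mphi _ _ (ltW q0)) _.
apply: lte_mul_pinfty; [by rewrite lee_fin powR_ge0|by []|exact: lte_add_pinfty gfin Pfin].
Qed.

Let humpP n := let: conj r0 gfin := hump_state_valid n in
  nextP (s := (n, hump_state n)) r0 gfin.

Lemma nneg_hump n : nneg_poly (hump n).
Proof. by have [[]] := humpP n. Qed.

Lemma radius_le m n : (m <= n)%N -> radius m <= radius n.
Proof.
move=> /subnK <-; elim: (n - m)%N => [|k ih]; first by rewrite add0n.
by apply: le_trans ih _; rewrite addSn; have [[]] := humpP (k + m).
Qed.

Lemma sum_half_pow n : \sum_(j < n) (2^-1 : R) ^+ j.+1 <= 1.
Proof.
suff -> : \sum_(j < n) (2^-1 : R) ^+ j.+1 = 1 - 2^-1 ^+ n.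
  by rewrite lerBlDr lerDl exprn_ge0 ?invr_ge0.
elim: n => [|n ih]; first by rewrite big_ord0 expr0 subrr.
by rewrite big_ord_recr/= ih [in LHS]exprS [in RHS]exprS; lra.
Qed.

Lemma hump_small n (r : R) : 0 <= r -> r <= 2 * radius n + n%:R ->
  (hump n).[r] <= 2^-1 ^+ n.+1 * damping (radius n).
Proof.
move=> r0 rn; have [[Pnn _] Pr _ _ _] := humpP n.
exact: le_trans (horner_nneg_le Pnn r0 rn) Pr.
Qed.

(** Radii increase, so the damping factors decrease and stay below [d], and the geometric factors
    sum to at most 1. *)
Lemma hump_tail n m (r d : R) : 0 <= r -> r <= 2 * radius n + n%:R ->
  damping (radius n) <= d -> \sum_(n <= j < m) (hump j).[r] <= d.
Proof.
move=> r0 rn dn; have d0 : 0 <= d by apply: le_trans dn; exact/ltW/damping_gt0.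
apply: (@le_trans _ _ (\sum_(n <= j < m) 2^-1 ^+ j.+1 * d)).
  rewrite big_nat_cond [leRHS]big_nat_cond; apply: ler_sum => j.
  rewrite andbT => /andP[nj _].
  apply: le_trans (hump_small r0 _) _.
    apply: le_trans rn _; apply: lerD; last by rewrite ler_nat.
    by rewrite ler_pM2l// radius_le.
  rewrite ler_pM2l ?exprn_gt0 ?invr_gt0//; apply: le_trans dn.
  by apply: damping_le; [have [] := hump_state_valid n | exact: radius_le].
rewrite -mulr_suml -[leRHS]mul1r ler_wpM2r//.
apply: le_trans (sum_half_pow m); rewrite -(big_mkord xpredT (fun j => 2^-1 ^+ j.+1)).
have half_ge0 j : 0 <= (2^-1 : R) ^+ j by rewrite exprn_ge0 ?invr_ge0.
have [nm|mn] := leqP n m.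
  by rewrite (big_cat_nat (leq0n n) nm)/= lerDr sumr_ge0.
by rewrite (big_geq (ltnW mn)) sumr_ge0.
Qed.

Lemma hump_sums_bounded (r : R) : 0 <= r ->
  exists B : R, forall n, \sum_(j < n) (hump j).[r] <= B.
Proof.
move=> r0; have [N rN] : exists N : nat, r <= N%:R.
  by exists (Num.truncn r).+1; exact/ltW/truncnS_gt.
have h0 j : 0 <= (hump j).[r] by apply: horner_nneg_ge0 => //; exact: nneg_hump.
have [rad0 _] := hump_state_valid N.
exists (\sum_(j < N) (hump j).[r] + damping (radius N)) => n.
apply: (@le_trans _ _ (\sum_(j < N + n) (hump j).[r])).
  rewrite -!(big_mkord xpredT (fun j => (hump j).[r])).
  rewrite [leRHS](big_cat_nat (leq0n n) (leq_addl N n))/=.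
  by rewrite lerDl sumr_ge0.
rewrite -!(big_mkord xpredT (fun j => (hump j).[r])).
rewrite (big_cat_nat (leq0n N) (leq_addr n N))/= lerD2l.
by apply: hump_tail => //; lra.
Qed.

Let f := fsum hump.

Let f_cvg z : cvgC (fun n => pev (psum hump n) z) (f z).
Proof. exact: fsum_cvg nneg_hump hump_sums_bounded z. Qed.

Let mf : cmeasurable f.
Proof.
apply: (@measurable_fun_cvg _ _ _ _
  (fun n w => cmod (pev (psum hump n) (toC w)))).
  by move=> n; exact: cmeasurable_pev.
by move=> w _; exact: cvgC_cmod (f_cvg (toC w)).
Qed.

(** The weights lost in splitting the power of the sum were already paid for in the choice of the
    humps; a geometric sum remains. *)
Lemma psum_fock_int n : (I setT p (pev (psum hump n)) <= 1)%E.
Proof.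
have mP (j : 'I_n) := measurable_wmod_pow mphi p (D := setT) (cmeasurable_pev (hump j)).
apply: (@le_trans _ _ (\sum_(j < n) (((2 ^+ j.+1) `^ p)%:E * I setT p (pev (hump j)))%E)); last first.
  apply: (@le_trans _ _ (\sum_(j < n) (2^-1 ^+ j.+1)%:E)%E).
    by apply: lee_sum => j _; have [] := humpP j.
  by rewrite sumEFin lee_fin sum_half_pow.
rewrite (eq_bigr (fun j : 'I_n => (\int[area R]_w
    (((2 ^+ j.+1) `^ p)%:E * (wmod phi (pev (hump j)) w `^ p)%:E))%E)); last first.
  move=> j _; rewrite (ge0_integralZl _ _ (mP j)) ?lee_fin ?powR_ge0//.
  by move=> w _; rewrite lee_fin powR_ge0.
rewrite -ge0_integral_sum//; last 2 first.
- by move=> j; exact: measurable_funeM.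
- by move=> j w _; rewrite -EFinM lee_fin mulr_ge0 ?powR_ge0.
apply: ge0_le_integral => //.
- by move=> w _; rewrite lee_fin powR_ge0.
- by apply: measurable_wmod_pow => //; exact: cmeasurable_pev.
- by apply: emeasurable_sum => j; exact: measurable_funeM.
move=> w _; under eq_bigr do rewrite -EFinM -powRM ?exprn_ge0 ?wmod_ge0//.
rewrite sumEFin lee_fin.
apply: le_trans (powR_sum_le n p0 (fun j => wmod_ge0 phi (pev (hump j)) w)).
apply: powR_mono; [exact: ltW|exact: wmod_ge0|].
rewrite /wmod -mulr_suml ler_wpM2r ?expR_ge0// /psum pev_sum.
exact: cmod_sum.
Qed.

(** Fatou's lemma carries the uniform bound on the partial sums over to the limit. *)
Lemma fsum_fock_int : (I setT p f <= 1)%E.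
Proof.
pose u n (w : plane R) := (wmod phi (pev (psum hump n)) w `^ p)%:E.
have mu n : measurable_fun setT (u n) by apply: measurable_wmod_pow => //; exact: cmeasurable_pev.
have uf w : limn_einf (u ^~ w) = (wmod phi f w `^ p)%:E.
  suff: u n w @[n --> \oo] --> (wmod phi f w `^ p)%:E by move=> /cvg_limn_einf_sup[].
  apply: cvg_EFin; first by near=> n.
  apply: cvg_powR => //; first by move=> n; exact: wmod_ge0.
  apply: cvgMr_tmp; exact: cvgC_cmod (f_cvg (toC w)).
have u0 n w : setT w -> (0 <= u n w)%E by rewrite lee_fin powR_ge0.
have := fatou (area R) measurableT mu u0.
rewrite (eq_integral (fun w => (wmod phi f w `^ p)%:E)); last by move=> w _; exact: uf.
move=> /le_trans; apply.
rewrite limn_einf_lim; apply: lime_le; first exact: is_cvg_einfs.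
near=> n; apply: le_trans (psum_fock_int n).
by apply: ereal_inf_lbound; exists n => /=.
Unshelve. all: by end_near. Qed.

Lemma fsum_fock_unbounded n : (n%:R%:E <= I setT q f)%E.
Proof.
have [[_ rr] _ _ _ big] := humpP n; have [rad0 gfin] := hump_state_valid n.
set rho := (next _).2 in rr big; have rho0 : 0 <= rho by exact: le_trans rad0 rr.
have radS : radius n.+1 = rho by [].
pose S := pev (psum hump n).
have mbox : measurable (box rho) by exact: measurableX.
pose d := damping rho.
pose a g (w : plane R) := (wmod phi g w `^ q)%:E.
have ma g : cmeasurable g -> measurable_fun (box rho) (a g).
  by move=> mg; exact: measurable_wmod_pow.
have a0 g w : (0 <= a g w)%E by rewrite lee_fin powR_ge0.
have mS : cmeasurable S by exact: cmeasurable_pev.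
have pw0 : (0 < (3 `^ q)%:E :> \bar R)%E by rewrite lte_fin powR_gt0.
have key : (I (box rho) q (pev (hump n)) <=
    (3 `^ q)%:E * (I (box rho) q f + I (box rho) q S + 1))%E.
  apply: (@le_trans _ _ (\int[area R]_(w in box rho)
      ((3 `^ q)%:E * (a f w + a S w + (d `^ q)%:E)))%E).
    apply: ge0_le_integral => //.
    - by move=> w _; exact: a0.
    - by apply: ma; exact: cmeasurable_pev.
    - apply: measurable_funeM; apply: emeasurable_funD => //.
      by apply: emeasurable_funD; exact: ma.
    move=> [x y] /= []; rewrite !in_itv/= => /andP[x1 x2] /andP[y1 y2].
    rewrite -!EFinD -EFinM lee_fin.
    apply: le_trans (powR_add3_le (ltW q0) (wmod_ge0 _ _ _) (wmod_ge0 _ _ _)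
      (ltW (damping_gt0 _))).
    apply: powR_mono; [exact: ltW|exact: wmod_ge0|].
    set z := toC (x, y); set T := pev (psum hump n.+1) z.
    (* The box of half-side [rho] lies in the disc of radius [2 * rho], where all later humps are
       controlled. *)
    have cz : cmod z <= 2 * rho.
      apply: le_trans (cmod_le_ReIm _) _ => /=.
      have : `|x| <= rho by rewrite ler_norml x1.
      have : `|y| <= rho by rewrite ler_norml y1.
      lra.
    have tail : cmod (f z - T) <= d.
      apply: fsum_tail => [j|r r0|m nm]; [exact: nneg_hump|exact: hump_sums_bounded|].
      apply: hump_tail; rewrite ?cmod_ge0 ?radS//.
      by apply: le_trans cz _; rewrite lerDl.
    have hE : pev (hump n) z = f z - S z - (f z - T).
      rewrite /T /S /psum big_ord_recr/= pevD; ring.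
    rewrite /wmod -/z hE.
    have e1 : expR (- phi (cmod z)) <= 1 by rewrite -expR0 ler_expR oppr_le0 phi_ge0 ?cmod_ge0.
    have e0 := expR_ge0 (- phi (cmod z)).
    have le3 : cmod (f z - S z - (f z - T)) <= cmod (f z) + cmod (S z) + cmod (f z - T).
      by apply: le_trans (cmodB _ _) _; rewrite lerD2r cmodB.
    apply: le_trans (ler_wpM2r e0 le3) _; rewrite !mulrDl lerD2l.
    by apply: le_trans tail; rewrite -[leRHS]mulr1 ler_wpM2l ?cmod_ge0.
  have mfS : measurable_fun (box rho) (fun w => a f w + a S w)%E.
    by apply: emeasurable_funD; exact: ma.
  have mfSd : measurable_fun (box rho) (fun w => a f w + a S w + (d `^ q)%:E)%E.
    exact: emeasurable_funD.
  have d0 : (0 <= (d `^ q)%:E)%E by rewrite lee_fin powR_ge0.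
  rewrite (ge0_integralZl _ mbox mfSd) ?lee_fin ?powR_ge0//; last first.
    by move=> w _; rewrite !adde_ge0.
  rewrite lee_pmul2l//.
  rewrite (ge0_integralD _ mbox _ mfS)//; last by move=> w _; rewrite adde_ge0.
  rewrite (ge0_integralD _ mbox _ (ma _ mf) _ (ma _ mS))//.
  (* The box has area [4 * rho ^+ 2], which [damping rho] was designed to compensate. *)
  rewrite leeD2l// integral_cst// area_rectangle; [|lra|lra].
  rewrite -EFinM lee_fin; apply: le_trans (damping_pow rho).
  by rewrite ler_wpM2l ?powR_ge0//; nra.
have gS : (I (box rho) q S <= I setT q (pev (hump_state n).1))%E.
  by rewrite -psum_hump; exact: fock_int_subset.
have {big key} := le_trans big key.
have pwf : (3 `^ q)%:E \is a fin_num by [].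
rewrite (lee_pmul2l pwf pw0) (leeD2rE _ _ (isT : 1%E \is a fin_num)) => big.
have fsub : (I (box rho) q f <= I setT q f)%E by exact: fock_int_subset.
apply: le_trans fsub.
have gnum : I setT q (pev (hump_state n).1) \is a fin_num.
  by rewrite ge0_fin_numE ?fock_int_ge0.
by rewrite -(leeD2rE _ _ gnum); apply: le_trans big _; rewrite leeD2l.
Qed.

Lemma gliding_hump : (fock phi p `\` fock phi q) !=set0.
Proof.
exists f; split.
  split; first exact: entire_fsum nneg_hump hump_sums_bounded.
  by rewrite fock_norm_powE; apply: le_lt_trans fsum_fock_int _; rewrite ltry.
move=> [_]; rewrite fock_norm_powE => fin.
have fnum : I setT q f \is a fin_num by rewrite ge0_fin_numE ?fock_int_ge0.
have := fsum_fock_unbounded (Num.truncn (fine (I setT q f))).+1.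
by rewrite -(fineK fnum) lee_fin leNgt truncnS_gt.
Qed.

End GlidingHump.

(** * Bumps of prescribed width *)

Section CauchyKernel.
Variable R : realType.
Local Notation mu := (@lebesgue_measure R).

(** The kernel [1 / (1 + x^2)]. Products of two scaled copies are integrable majorants on the plane
    whose integral factors by Tonelli's theorem. *)
Definition cauchy (x : R) : R := (oneDsqr x)^-1.

Lemma cauchy_ge0 x : 0 <= cauchy x.
Proof. by rewrite invr_ge0 ltW// oneDsqr_gt0. Qed.

Lemma measurable_cauchy : measurable_fun setT cauchy.
Proof. by apply: continuous_measurable_fun; exact: continuous_oneDsqrV. Qed.

Lemma integral_cauchy : (\int[mu]_x (cauchy x)%:E)%E = pi%:E.
Proof.
rewrite ge0_symfun_integralT; first last.
- by move=> x; rewrite /cauchy /oneDsqr /= sqrrN.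
- exact: continuous_oneDsqrV.
- exact: cauchy_ge0.
have -> : [set x : R | 0 <= x] = `[0, +oo[%classic.
  by apply/seteqP; split => x /=; rewrite in_itv/= andbT.
by rewrite integral0y_oneDsqr -EFinM; congr EFin; field.
Qed.

Lemma integral_cauchy_scale (a sigma : R) : 0 < sigma ->
  (\int[mu]_x (cauchy ((x - a) / sigma))%:E)%E = (sigma * pi)%:E.
Proof.
move=> s0; pose F x := (x - a) / sigma.
have F'E : (F^`())%classic = cst sigma^-1.
  apply/funext => x; rewrite derive1E /F.
  by rewrite derive_val; rewrite ?scaler0 ?add0r ?addr0 ?subr0 /GRing.scale/= ?mulr1 ?mul1r.
have mF : measurable_fun setT (fun x => (cauchy (F x) * sigma^-1)%:E).
  apply: measurableT_comp => //; apply: measurable_funM => //.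
  apply: measurableT_comp; first exact: measurable_cauchy.
  by apply: measurable_funM => //; exact: measurable_funB.
have -> : (\int[mu]_x (cauchy ((x - a) / sigma))%:E)%E =
    (sigma%:E * \int[mu]_x (cauchy (F x) * sigma^-1)%:E)%E.
  rewrite -ge0_integralZl//; first last.
  - by rewrite lee_fin ltW.
  - by move=> x _; rewrite lee_fin mulr_ge0 ?cauchy_ge0// invr_ge0 ltW.
  by apply: eq_integral => x _; rewrite -EFinM mulrCA mulfV ?mulr1// gt_eqF.
rewrite EFinM; congr (_ * _)%E.
rewrite -integral_cauchy [RHS](@increasing_ge0_integration_by_substitutionT _ F)//.
- by apply: eq_integral => x _; rewrite !fctE F'E.
- by move=> x y xy; rewrite /F ltr_pM2r ?invr_gt0// ltrD2r.
- by rewrite F'E => ?; exact: cvg_cst.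
- by rewrite F'E; exact: is_cvg_cst.
- by rewrite F'E; exact: is_cvg_cst.
- by apply/gt0_cvgMlNy; [rewrite invr_gt0|exact: cvg_addrr_Ny].
- by apply/gt0_cvgMly; [rewrite invr_gt0|exact: cvg_addrr].
- exact: continuous_oneDsqrV.
- exact: cauchy_ge0.
Qed.

Lemma measurable_cauchy2 (a sigma : R) : measurable_fun setT
  (fun w : plane R => (cauchy ((w.1 - a) / sigma) * cauchy (w.2 / sigma))%:E).
Proof.
apply: measurableT_comp => //; apply: measurable_funM.
- apply: measurableT_comp; first exact: measurable_cauchy.
  by apply: measurable_funM => //; apply: measurable_funB => //; exact: measurable_fst.
- apply: measurableT_comp; first exact: measurable_cauchy.
  by apply: measurable_funM => //; exact: measurable_snd.
Qed.

Lemma integral_cauchy2 (a sigma : R) : 0 < sigma ->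
  (\int[area R]_w (cauchy ((w.1 - a) / sigma) * cauchy (w.2 / sigma))%:E)%E =
  ((sigma * pi) ^+ 2)%:E.
Proof.
move=> s0.
pose f (w : plane R) := (cauchy ((w.1 - a) / sigma) * cauchy (w.2 / sigma))%:E.
have f0 w : (0 <= f w)%E by rewrite lee_fin mulr_ge0 ?cauchy_ge0.
transitivity (\int[mu]_x fubini_F mu f x)%E.
  exact: (fubini_tonelli1 f (measurable_cauchy2 a sigma) f0).
have inner x : fubini_F mu f x = ((sigma * pi)%:E * (cauchy ((x - a) / sigma))%:E)%E.
  rewrite /fubini_F /f /=.
  have mc : measurable_fun setT (fun y : R => (cauchy ((y - 0) / sigma))%:E).
    apply: measurableT_comp => //; apply: measurableT_comp; first exact: measurable_cauchy.
    by apply: measurable_funM => //; exact: measurable_funB.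
  rewrite -(integral_cauchy_scale 0 s0) muleC.
  rewrite -[RHS](ge0_integralZl mu measurableT mc).
  - by apply: eq_integral => y _; rewrite subr0 EFinM.
  - by move=> y _; rewrite lee_fin cauchy_ge0.
  - by rewrite lee_fin cauchy_ge0.
under eq_integral do rewrite inner.
rewrite ge0_integralZl//; first last.
- by rewrite lee_fin mulr_ge0 ?pi_ge0// ltW.
- by move=> y _; rewrite lee_fin cauchy_ge0.
- apply: measurableT_comp => //; apply: measurableT_comp; first exact: measurable_cauchy.
  by apply: measurable_funM => //; exact: measurable_funB.
by rewrite integral_cauchy_scale// -EFinM expr2.
Qed.

End CauchyKernel.

(** * From decay at a given width to humps by scaling *)

Section Profiles.
Variables (R : realType) (phi : R -> R).
Hypothesis mphi : measurable_fun setT (fun w : plane R => phi (cmod (toC w))).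
Implicit Types (f : R[i] -> R[i]) (p q C a sigma : R) (k : nat).

(** The bound [C * min (1, (sigma / |z - a|)^k)] on the weighted modulus, written without division
    so that [z = a] needs no exception. *)
Definition decays f C a sigma k : Prop := forall z,
  cmod (f z) * expR (- phi (cmod z)) <= C /\
  cmod (f z) * expR (- phi (cmod z)) * cmod (z - real_complex R a) ^+ k
    <= C * sigma ^+ k.

(** With [rho = |z - a| / sigma], the condition [4 <= k p] gives decay like [rho ^- 4], while [(1 +
    u^2) * (1 + v^2) <= (1 + rho^2)^2 <= 4 * max (1, rho^4)]. *)
Lemma decays_pow_le f C a sigma k p w : 0 < p -> 4 <= k%:R * p -> 0 < C ->
  0 < sigma -> decays f C a sigma k ->
  wmod phi f w `^ p <=
    4 * C `^ p * (cauchy ((w.1 - a) / sigma) * cauchy (w.2 / sigma)).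
Proof.
move=> p0 kp C0 s0 /(_ (toC w)) []; rewrite -/(wmod phi f w).
set x := wmod phi f w => xC xk; have x0 : 0 <= x by exact: wmod_ge0.
set u := (w.1 - a) / sigma; set v := w.2 / sigma.
have u0 := sqr_ge0 u; have v0 := sqr_ge0 v.
rewrite /cauchy /oneDsqr -invfM ler_pdivlMr; last by rewrite mulr_gt0; lra.
have Cp0 : 0 < C `^ p by rewrite powR_gt0.
have xCp : x `^ p <= C `^ p by apply: powR_mono => //; exact: ltW.
have xp0 := powR_ge0 x p.
pose rho := cmod (toC w - real_complex R a) / sigma.
have rho0 : 0 <= rho by rewrite divr_ge0 ?cmod_ge0// ltW.
have rhoE : rho ^+ 2 = u ^+ 2 + v ^+ 2.
  rewrite /rho expr_div_n cmod_sqr /= subr0 mulrDl; congr (_ + _);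
  by rewrite -expr_div_n.
have uv : (1 + u ^+ 2) * (1 + v ^+ 2) <= (1 + rho ^+ 2) ^+ 2 by rewrite rhoE; nra.
have uv0 : 0 <= (1 + u ^+ 2) * (1 + v ^+ 2) by rewrite mulr_ge0; lra.
have [rho1|rho1] := leP rho 1.
  apply: (@le_trans _ _ (C `^ p * 4)); last by rewrite mulrC.
  have h1 : rho ^+ 2 <= 1 by nra.
  have h0 := sqr_ge0 rho.
  by rewrite ler_pM//; apply: le_trans uv _; set v2 := rho ^+ 2 in h0 h1 *; nra.
have {}xk : x * rho ^+ k <= C.
  by rewrite /rho expr_div_n mulrA ler_pdivrMr ?exprn_gt0.
have xrho : x `^ p * rho ^+ 4 <= C `^ p.
  apply: (@le_trans _ _ ((x * rho ^+ k) `^ p)); last first.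
    by apply: powR_mono => //; [exact: ltW|rewrite mulr_ge0 ?exprn_ge0].
  rewrite powRM ?exprn_ge0// ler_wpM2l// -!powR_mulrn// -powRrM.
  by apply: ler_powR => //; exact: ltW.
apply: (@le_trans _ _ (x `^ p * (4 * rho ^+ 4))).
  have h1 : 1 <= rho ^+ 2 by nra.
  have -> : rho ^+ 4 = rho ^+ 2 ^+ 2 by rewrite -exprM.
  by rewrite ler_wpM2l//; apply: le_trans uv _; set v2 := rho ^+ 2 in h1 *; nra.
by rewrite mulrCA ler_pM2l.
Qed.

Lemma fock_int_decays f C a sigma k p : cmeasurable f -> 0 < p ->
  4 <= k%:R * p -> 0 < C -> 0 < sigma -> decays f C a sigma k ->
  (fock_int phi setT p f <= (4 * C `^ p * (sigma * pi) ^+ 2)%:E)%E.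
Proof.
move=> mf p0 kp C0 s0 df; rewrite EFinM -(integral_cauchy2 a s0).
have mc := measurable_cauchy2 a sigma.
have c0 : 0 <= 4 * C `^ p by rewrite mulr_ge0 ?powR_ge0.
rewrite -(ge0_integralZl _ _ mc)//; last first.
  by move=> w _; rewrite lee_fin mulr_ge0 ?cauchy_ge0.
apply: ge0_le_integral => //.
- by move=> w _; rewrite lee_fin powR_ge0.
- exact: measurable_wmod_pow.
- exact: measurable_funeM.
by move=> w _; rewrite -EFinM lee_fin; exact: decays_pow_le p0 kp C0 s0 df.
Qed.

Lemma small_powR (e A eps : R) : 0 < e -> 0 < A -> 0 < eps ->
  exists2 x0, 0 < x0 & forall x, 0 < x -> x <= x0 -> A * x `^ e <= eps.
Proof.
move=> e0 A0 eps0; have q0 : 0 < eps / A by rewrite divr_gt0.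
exists ((eps / A) `^ e^-1) => [|x x0 xx0]; first by rewrite powR_gt0.
rewrite mulrC -ler_pdivlMr//.
apply: le_trans (powR_mono (ltW e0) (ltW x0) xx0) _.
by rewrite -powRrM mulVf ?gt_eqF// powRr1// ltW.
Qed.

(* [x] is the small parameter and [x^s] the width of the bump, which is scaled
   by [x^(- s t)]. *)
Lemma humps_of_family p q (s t g C c : R) k : 0 < p -> 0 < q ->
  4 <= k%:R * p -> 4 <= k%:R * q -> 0 < C -> 0 < c ->
  0 < s * (2 - p * t) -> s * (2 - q * t) < 0 -> 0 < g - s * t ->
  (forall r : R, 0 <= r -> exists2 D : R, 0 < D & forall x0 : R, 0 < x0 ->
     exists (x a : R) (P : {poly R}) (rho : R), [/\ 0 < x <= x0, nneg_poly P,
       decays (pev P) C a (x `^ s) k,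
       ((c * (x `^ s) ^+ 2)%:E <=
          fock_int phi (box rho) q (pev P))%E &
       P.[r] <= D * x `^ g]) ->
  humps phi p q.
Proof.
move=> p0 q0 kp kq C0 c0 sp sq gs fam e r M e0 r0.
have [D D0 {}fam] := fam r r0.
have pi0 : 0 < pi :> R by exact: pi_gt0.
have A0 : 0 < 4 * C `^ p * pi ^+ 2 by rewrite !mulr_gt0 ?powR_gt0 ?exprn_gt0.
have M0 : 0 < `|M| + 1 by rewrite ltr_wpDl.
have sq' : 0 < - (s * (2 - q * t)) by rewrite oppr_gt0.
have [x1 x1_gt0 small1] := small_powR sp A0 e0.
have [x2 x2_gt0 small2] := small_powR sq' M0 c0.
have [x3 x3_gt0 small3] := small_powR gs D0 e0.
have [] := fam (Num.min x1 (Num.min x2 x3)); first by rewrite !lt_min x1_gt0 x2_gt0.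
move=> x [a [P [rho [/andP[x0 xmin] Pnn dP low Pr]]]].
move: xmin; rewrite !le_min => /andP[xx1 /andP[xx2 xx3]].
pose l := x `^ (- (s * t)); have l0 : 0 < l by rewrite powR_gt0.
have xs0 : 0 < x `^ s by rewrite powR_gt0.
(* Up to constants this is the [u]-th integral of the scaled bump. The exponent is positive for
   [u = p] and negative for [u = q], so as [x -> 0] one integral vanishes while the other blows
   up. *)
have lpow u : l `^ u * (x `^ s) ^+ 2 = x `^ (s * (2 - u * t)).
  rewrite /l -powRrM -powR_mulrn ?powR_ge0// -powRrM -powRD; last first.
    by apply/implyP => _; rewrite gt_eqF.
  by congr (_ `^ _); ring.
have scaled u : 0 < u -> 4 <= k%:R * u ->
    (fock_int phi setT u (pev (l *: P)) <=
     (4 * C `^ u * pi ^+ 2 * x `^ (s * (2 - u * t)))%:E)%E.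
  move=> u0 ku; rewrite (fock_intZ mphi _ _ _ (ltW l0))//.
  apply: (@le_trans _ _ ((l `^ u)%:E * (4 * C `^ u * (x `^ s * pi) ^+ 2)%:E)%E).
    apply: lee_wpmul2l; first by rewrite lee_fin powR_ge0.
    exact: fock_int_decays (cmeasurable_pev P) u0 ku C0 xs0 dP.
  rewrite -EFinM lee_fin -lpow.
  by rewrite le_eqVlt; apply/orP; left; apply/eqP; ring.
exists (l *: P), rho; split.
- exact: nneg_polyZ (ltW l0) Pnn.
- rewrite hornerZ; apply: le_trans (ler_wpM2l (ltW l0) Pr) _.
  rewrite mulrCA -powRD; last by apply/implyP => _; rewrite gt_eqF.
  by rewrite addrC small3.
- by apply: le_trans (scaled p p0 kp) _; rewrite lee_fin small1.
- by apply: le_lt_trans (scaled q q0 kq) _; rewrite ltry.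
- rewrite (fock_intZ mphi _ _ _ (ltW l0))//; last exact: measurableX.
  apply: (@le_trans _ _ ((l `^ q)%:E * (c * x `^ s ^+ 2)%:E)%E); last first.
    by apply: lee_wpmul2l; rewrite ?lee_fin ?powR_ge0.
  rewrite -EFinM lee_fin mulrCA lpow.
  have := small2 x x0 xx2; rewrite powRN -ler_pdivlMr ?invr_gt0 ?powR_gt0// invrK.
  by apply: le_trans; have := ler_norm M; lra.
Qed.

End Profiles.

(** * Concentrated bumps *)

Section Concentrated.
Variables (R : realType) (phi G H dl : R -> R).
Local Notation F := (fun t : R => phi (expR t)).
Hypothesis rg : regular_growth F G H dl.
Variable k : nat.

Lemma cmod_gt0_expR (z : R[i]) : z != 0 -> exists s, cmod z = expR s.
Proof.
move=> z0; have c0 : 0 < cmod z.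
  by rewrite lt_neqAle cmod_ge0 andbT eq_sym; apply: contra z0 => /eqP/cmod_eq0/eqP.
by exists (ln (cmod z)); rewrite lnK// posrE.
Qed.

Lemma trunc_bounds (x : R) : 0 <= x ->
  (Num.truncn x)%:R <= x /\ x <= (Num.truncn x)%:R + 1.
Proof.
by move=> /truncn_itv/andP[h1 h2]; split => //; move: h2; rewrite -natr1 => /ltW.
Qed.

Lemma cmod_geometric_le (N : nat) (z : R[i]) (u : R) : cmod z = expR u ->
  cmod (\sum_(j < N) z ^+ j) <= N%:R * expR (N%:R * `|u|).
Proof.
move=> zu; apply: le_trans (cmod_sum _ _ _) _.
have -> : N%:R * expR (N%:R * `|u|) = \sum_(j < N) expR (N%:R * `|u|).
  by rewrite sumr_const card_ord mulr_natl.
apply: ler_sum => j _; rewrite cmodX zu -expRM_natl ler_expR.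
apply: le_trans (ler_wpM2l (ler0n _ _) (ler_norm u)) _.
by rewrite ler_wpM2r// ler_nat ltnW.
Qed.

(** The product telescopes to [z ^+ N - 1]. The estimate also has force on the circle [|z| = 1],
    where it provides the angular decay. *)
Lemma cmod_geometric_decay (N : nat) (z : R[i]) (u : R) : cmod z = expR u ->
  cmod (\sum_(j < N) z ^+ j) * cmod (z - 1) <= 2 * expR (N%:R * `|u|).
Proof.
move=> zu; rewrite -cmodM mulrC -subrX1; apply: le_trans (cmodB _ _) _.
rewrite cmod1 cmodX zu -expRM_natl.
have h1 : expR (N%:R * u) <= expR (N%:R * `|u|).
  by rewrite ler_expR ler_wpM2l// ler_norm.
have h2 : 1 <= expR (N%:R * `|u|) by rewrite -expR0 ler_expR mulr_ge0.
lra.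
Qed.

(** Keeps all terms of the geometric sum close to 1 near the peak, so that they cannot cancel
    there. *)
Lemma cmod_exp_sub1 (z : R[i]) (v : R) j : cmod (z - 1) <= v ->
  cmod (z ^+ j - 1) <= expR (j%:R * v) - 1.
Proof.
move=> zv; have v0 : 0 <= v := le_trans (cmod_ge0 _) zv.
elim: j => [|j ih]; first by rewrite expr0 !subrr mul0r expR0 subrr cmod0.
have -> : z ^+ j.+1 - 1 = z * (z ^+ j - 1) + (z - 1) by rewrite exprS; ring.
apply: le_trans (cmodD _ _) _; rewrite cmodM.
have z1 : cmod z <= 1 + v.
  have -> : z = 1 + (z - 1) by ring.
  by apply: le_trans (cmodD _ _) _; rewrite cmod1 lerD2l.
have ev := expR_ge1Dx v.
have -> : j.+1%:R * v = v + j%:R * v by rewrite -natr1; ring.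
rewrite expRD; have := cmod_ge0 z; have := cmod_ge0 (z ^+ j - 1).
nra.
Qed.

Lemma expR_quarter : expR (4^-1) <= 4 / 3 :> R.
Proof.
have h := expR_ge1Dx (- 4^-1 : R).
have h2 : expR (4^-1) * expR (- 4^-1) = 1 :> R by rewrite -expRD subrr expR0.
have := expR_gt0 (4^-1 : R); nra.
Qed.

(* The peak at [a = e^t]: a monomial adapted to [phi] at radius [a], times a
   power of a normalised geometric sum of about [1 / dl t] terms, which
   localises it in the angular direction. *)
Lemma concentrated : exists C t0, 0 < C /\ forall t, t0 <= t ->
  exists P, [/\ nneg_poly P,
    decays phi (pev P) C (expR t) (expR t * dl t) k &
    forall x y : R, 0 <= x <= expR t * dl t / 16 -> 0 <= y <= expR t * dl t / 16 ->
      C^-1 <= wmod phi (pev P) (expR t + x, y)].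
Proof.
(* The part [2 * k] pays for the growth [e^(k N |u|)] of the [k]-th power of the geometric sum, as
   [N <= 2 / d]; the part [1] pays for rounding [G t] to an integer. *)
have k0 : 0 < 2 * k%:R + 1 :> R by rewrite ltr_wpDl ?mulr_ge0.
have [C1 [t1 [C1_gt0 gap]]] := tangent_linear_gap rg k0.
have [C2 [t2 [C2_gt0 near]]] := tangent_near rg.
have [t3 dl1] := dl_small rg ltr01.
have [t4 G1] := slope_large rg 1.
(* [C1] and the factor 2 of the telescoped sum enter the upper bounds; [C2], the rounding error 1
   and the lower bound [1 / 2] for [Q] enter the lower one. *)
pose C := expR (C1 + C2 + 1) * 2 ^+ k.
have C0 : 0 < C by rewrite mulr_gt0 ?expR_gt0 ?exprn_gt0.
exists C, (Num.max (Num.max t1 t2) (Num.max t3 t4)); split => // t.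
rewrite !ge_max => /andP[/andP[/gap {}gap /near {}near] /andP[/dl1 {}dl1 /G1 {}G1]].
have d0 := rg_dl rg t.
set a := expR t; set d := dl t in gap near d0 dl1 *.
have a0 : 0 < a by exact: expR_gt0.
set m := Num.truncn (G t).
have [m1 m2] := trunc_bounds (le_trans ler01 G1); rewrite -/m in m1 m2.
(* A positive degree makes [P] vanish at 0, the one point whose modulus is not some [e^s]. *)
have m_gt0 : (0 < m)%N by rewrite truncn_gt0.
have dV0 : 0 <= d^-1 by rewrite invr_ge0 ltW.
have dV1 : 1 <= d^-1 by rewrite -invr1 lef_pV2 ?posrE.
set N := (Num.truncn d^-1).+1.
have [N1 N2] : d^-1 <= N%:R /\ N%:R <= 2 * d^-1.
  by have [] := trunc_bounds dV0; rewrite /N -natr1; lra.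
have N0 : 0 < N%:R :> R by lra.
pose Z : {poly R} := a^-1 *: 'X.
pose Q : {poly R} := N%:R^-1 *: \sum_(j < N) Z ^+ j.
pose P := expR (F t) *: (Z ^+ m * Q ^+ k).
have Znn : nneg_poly Z by apply: nneg_polyZ; [rewrite invr_ge0 ltW|exact: nneg_polyX].
have Qnn : nneg_poly Q.
  apply: nneg_polyZ; first by rewrite invr_ge0 ltW.
  by apply: nneg_poly_sum => j; exact: nneg_poly_exp.
pose zeta z := pev Z z.
have zetaE z : zeta z = real_complex R a^-1 * z by rewrite /zeta pevZ pevX.
have aC : real_complex R a^-1 * real_complex R a = 1.
  by rewrite -rmorphM/= mulVf ?gt_eqF.
have czeta z : cmod (zeta z) = cmod z / a.
  by rewrite zetaE cmodM cmod_real ger0_norm ?invr_ge0 ?ltW// mulrC.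
have czeta1 z : cmod (zeta z - 1) = cmod (z - real_complex R a) / a.
  by rewrite zetaE -aC -mulrBr cmodM cmod_real ger0_norm ?invr_ge0 ?ltW// mulrC.
pose S z := \sum_(j < N) zeta z ^+ j.
have cQ z : cmod (pev Q z) = cmod (S z) / N%:R.
  rewrite /Q pevZ cmodM cmod_real ger0_norm ?invr_ge0 ?ler0n// mulrC pev_sum.
  by congr (cmod _ / _); apply: eq_bigr => j _; rewrite pev_exp.
have cP z : cmod (pev P z) = expR (F t) * (cmod (zeta z) ^+ m * cmod (pev Q z) ^+ k).
  by rewrite /P pevZ cmodM cmod_real ger0_norm ?expR_ge0// pevM !pev_exp cmodM !cmodX.
have wP z s : cmod z = expR s -> cmod (pev P z) * expR (- phi (cmod z)) =
    expR (F t + m%:R * (s - t) - F s) * cmod (pev Q z) ^+ k.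
  move=> zs; rewrite cP czeta zs -expRN -expRD -expRM_natl mulrAC mulrA.
  by rewrite -!expRD; congr (expR _ * _); ring.
exists P; split.
- apply: nneg_polyZ; first exact: expR_ge0.
  by apply: nneg_polyM; exact: nneg_poly_exp.
- move=> z; have [->|z0] := eqVneq z 0.
    have -> : cmod (pev P 0) = 0.
      by rewrite cP czeta cmod0 mul0r expr0n gtn_eqF// mul0r mulr0.
    rewrite !mul0r; split; first exact: ltW.
    by rewrite mulr_ge0 ?exprn_ge0 ?mulr_ge0 ?expR_ge0// ltW.
  have [s zs] := cmod_gt0_expR z0; rewrite (wP _ _ zs).
  set u := s - t.
  have zetau : cmod (zeta z) = expR u by rewrite czeta zs -expRN -expRD.
  pose E := expR (N%:R * `|u|).
  have E0 : 0 < E by exact: expR_gt0.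
  have Q1 : cmod (pev Q z) <= E.
    by rewrite cQ ler_pdivrMr// mulrC; exact: cmod_geometric_le.
  have Q2 : cmod (pev Q z) * cmod (z - real_complex R a) <= 2 * E * (a * d).
    have -> : cmod (z - real_complex R a) = a * cmod (zeta z - 1).
      by rewrite czeta1 mulrCA mulfV ?mulr1// gt_eqF.
    rewrite mulrCA [leRHS]mulrCA ler_pM2l// cQ mulrAC ler_pdivrMr//.
    apply: le_trans (cmod_geometric_decay N zetau) _; rewrite -/E.
    have : 1 <= d * N%:R by rewrite mulrC -ler_pdivrMr// mul1r.
    by have := E0; nra.
  have expo : expR (F t + m%:R * u - F s) * E ^+ k <= expR C1.
    rewrite /E -expRM_natl -expRD ler_expR.
    have := gap s; rewrite -/u => gaps.
    have u0 := normr_ge0 u.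
    have mu : m%:R * u <= G t * u + `|u|.
      have := ler_norm u; have := ler_norm (- u); rewrite normrN; nra.
    have kN : k%:R * (N%:R * `|u|) + `|u| <= (2 * k%:R + 1) / d * `|u|.
      have kk := ler0n R k.
      have : k%:R * N%:R + 1 <= (2 * k%:R + 1) / d by rewrite /=; nra.
      nra.
    lra.
  have Q0 := cmod_ge0 (pev Q z).
  have CE : expR C1 * 2 ^+ k <= C.
    by rewrite ler_wpM2r ?exprn_ge0// ler_expR; lra.
  have two : 1 <= 2 ^+ k :> R by rewrite exprn_ege1// ler1n.
  split.
    apply: (@le_trans _ _ (expR C1)).
      apply: le_trans expo; rewrite ler_wpM2l ?expR_ge0// lerXn2r ?nnegrE// ltW//.
    by apply: le_trans CE; rewrite ler_peMr ?expR_ge0.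
  rewrite -mulrA -exprMn.
  apply: (@le_trans _ _ (expR (F t + m%:R * u - F s) * (2 * E * (a * d)) ^+ k)).
    rewrite ler_wpM2l ?expR_ge0// lerXn2r ?nnegrE ?mulr_ge0 ?cmod_ge0 ?(ltW E0) ?(ltW a0) ?(ltW d0)//.
  have adk : 0 <= (a * d) ^+ k by rewrite exprn_ge0 ?mulr_ge0 ?ltW.
  rewrite [(2 * E * _) ^+ k]exprMn mulrA; apply: ler_wpM2r => //.
  by rewrite exprMn mulrCA mulrC; apply: le_trans CE; rewrite ler_wpM2r ?exprn_ge0.
- move=> x y /andP[x0 x1] /andP[y0 y1].
  pose z := toC (a + x, y); rewrite /wmod -/z.
  have za : cmod (z - real_complex R a) <= a * d / 8.
    apply: le_trans (cmod_le_ReIm _) _ => /=.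
    rewrite subr0 addrAC subrr add0r !ger0_norm//; lra.
  have zeta1 : cmod (zeta z - 1) <= d / 8.
    by rewrite czeta1 ler_pdivrMr//; apply: le_trans za _; lra.
  have aR : a <= cmod z.
    apply: le_trans (cmod_ge_Re _) => /=; rewrite ger0_norm; lra.
  have z0 : z != 0 by apply/eqP => zE; move: aR; rewrite zE cmod0; lra.
  have [s zs] := cmod_gt0_expR z0.
  pose u := s - t.
  have zetau : cmod (zeta z) = expR u by rewrite czeta zs -expRN -expRD.
  have u0 : 0 <= u by rewrite subr_ge0 -ler_expR -zs.
  have ud : u <= d.
    rewrite -ler_expR -zetau; apply: le_trans (expR_ge1Dx _).
    have -> : zeta z = 1 + (zeta z - 1) by ring.
    by apply: le_trans (cmodD _ _) _; rewrite cmod1; lra.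
  have Qlow : 2^-1 <= cmod (pev Q z).
    (* As [N * d <= 2], the exponents [j * d / 8] are at most [1 / 4], so each of the [N] terms is
       within [e^(1/4) - 1 <= 1 / 3] of 1. *)
    have SN : cmod (S z - N%:R) <= N%:R / 3.
      have -> : S z - N%:R = \sum_(j < N) (zeta z ^+ j - 1).
        by rewrite sumrB sumr_const card_ord.
      apply: le_trans (cmod_sum _ _ _) _.
      have -> : N%:R / 3 = \sum_(j < N) (3^-1 : R).
        by rewrite sumr_const card_ord mulr_natl.
      apply: ler_sum => j _; apply: le_trans (cmod_exp_sub1 j zeta1) _.
      have jq : j%:R * (d / 8) <= 4^-1.
        have jN : j%:R <= N%:R :> R by rewrite ler_nat ltnW.
        have : N%:R * d <= 2 by rewrite -ler_pdivlMr.
        nra.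
      by have := expR_quarter; rewrite -(ler_expR) in jq; lra.
    have : N%:R <= cmod (S z) + cmod (S z - N%:R).
      have -> : N%:R = cmod (S z - (S z - N%:R)).
        rewrite opprB addrCA subrr addr0.
        have -> : N%:R = real_complex R N%:R :> R[i] by rewrite rmorph_nat.
        by rewrite cmod_real ger0_norm.
      exact: cmodB.
    rewrite cQ ler_pdivlMr//; lra.
  rewrite (wP _ _ zs) -/u.
  have h1 : expR (- (C2 + 1)) <= expR (F t + m%:R * u - F s).
    rewrite ler_expR; have := near s; rewrite -/u ger0_norm// => /(_ ud).
    nra.
  have h2 : (2 ^+ k)^-1 <= cmod (pev Q z) ^+ k.
    by rewrite -exprVn lerXn2r ?nnegrE ?invr_ge0 ?cmod_ge0.
  rewrite /C invfM -expRN; apply: ler_pM; rewrite ?expR_ge0 ?invr_ge0 ?exprn_ge0//.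
  by apply: le_trans h1; rewrite ler_expR; lra.
Qed.

End Concentrated.

(** * Spread-out sums of monomials *)

Section SubsetSums.
Variable R : realType.

(* For any [j], toggling [j] in [S] changes the partial sum by [a j], so at
   least half of all partial sums are at least [a j / 2] in modulus. *)
Lemma subset_sums_large n (a : 'I_n -> R[i]) (q d : R) (j : 'I_n) :
  0 < q -> 0 <= d -> d <= cmod (a j) ->
  #|{set 'I_n}|%:R * (d / 2) `^ q / 2 <=
    \sum_(S : {set 'I_n}) cmod (\sum_(i in S) a i) `^ q.
Proof.
move=> q0 d0 dj.
pose flip (S : {set 'I_n}) := if j \in S then S :\ j else j |: S.
have flipK : involutive flip.
  move=> S; rewrite /flip; have [jS|jS] := boolP (j \in S).
    by rewrite finset.setD11 finset.setD1K.
  by rewrite finset.setU11 finset.setU1K.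
pose x (S : {set 'I_n}) := cmod (\sum_(i in S) a i).
have x0 S : 0 <= x S by exact: cmod_ge0.
have pair S : (d / 2) `^ q <= x S `^ q + x (flip S) `^ q.
  have xx : d <= x S + x (flip S).
    apply: le_trans dj _; rewrite /x /flip.
    case: ifPn => jS.
      rewrite (big_setD1 j jS) /=.
      set s := \sum_(_ in _) _.
      have {1}-> : a j = a j + s - s by rewrite addrK.
      exact: cmodB.
    rewrite (big_setU1 _ jS) /=; set s := \sum_(_ in _) _.
    have {1}-> : a j = a j + s - s by rewrite addrK.
    by rewrite [leRHS]addrC; exact: cmodB.
  have [le_x|lt_x] := leP (d / 2) (x S).
    apply: (@le_trans _ _ (x S `^ q)); last by rewrite lerDl powR_ge0.
    by apply: powR_mono => //; [exact: ltW|rewrite divr_ge0].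
  apply: (@le_trans _ _ (x (flip S) `^ q)); last by rewrite lerDr powR_ge0.
  by apply: powR_mono; [exact: ltW|rewrite divr_ge0|lra].
have : \sum_(S : {set 'I_n}) (d / 2) `^ q <=
    \sum_S (x S `^ q + x (flip S) `^ q) by apply: ler_sum => S _; exact: pair.
rewrite big_split /= sumr_const -[_ *+ #|_|]mulr_natl.
(* [flip] permutes the subsets, so the sum over pairs is twice the sum wanted. *)
have <- : \sum_(S : {set 'I_n}) x S `^ q = \sum_S x (flip S) `^ q.
  exact: (reindex_inj (inv_inj flipK)).
by rewrite -[in leRHS]mulr2n -[in leRHS]mulr_natr -ler_pdivrMr.
Qed.

End SubsetSums.

Section Spread.
Variables (R : realType) (phi G H dl : R -> R).
Local Notation F := (fun t : R => phi (expR t)).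
Hypothesis mphi : measurable_fun setT (fun w : plane R => phi (cmod (toC w))).
Hypothesis rg : regular_growth F G H dl.
Variable k : nat.

(** * Monomials normalised at the nodes, and their sums *)

Section Nodes.
Variables (t0 c C1 C2 : R).
Hypotheses (t0_ge0 : 0 <= t0) (c_gt0 : 0 < c).
Hypothesis G_ge1 : forall t, t0 <= t -> 1 <= G t.
Hypothesis dl_le1 : forall t, t0 <= t -> dl t <= 1.
Hypothesis dl_lec : forall t, t0 <= t -> dl t <= c / 2.
Hypothesis step : forall t, t0 <= t ->
  F t + G t * dl t + c <= F (t + dl t) /\
  F (t + dl t) - G (t + dl t) * dl t + c <= F t.
Hypothesis near : forall t s, t0 <= t ->
  `|s - t| <= dl t -> F s <= F t + G t * (s - t) + C2.
Hypothesis gap : forall t s, t0 <= t ->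
  F t + G t * (s - t) + (k%:R + 1) / dl t * `|s - t| - C1 <= F s.

Fixpoint node (j : nat) : R := if j is i.+1 then node i + dl (node i) else t0.

Lemma node_ge j : t0 <= node j.
Proof.
elim: j => [//|j ih] /=; apply: le_trans ih _.
by rewrite lerDl ltW// (rg_dl rg).
Qed.

Lemma node_lt j : node j < node j.+1.
Proof. by rewrite /= ltrDl (rg_dl rg). Qed.

(** While the nodes stay below [B] their steps [dl] are bounded away from 0, so they would exceed
    [B] after finitely many steps. *)
Lemma node_unbounded B : exists j, B <= node j.
Proof.
have [e e0 he] := rg_dl_low rg B.
have [|none] := pselect (exists j, B <= node j); first by [].
have lt_B j : node j < B by rewrite ltNge; apply/negP => Bj; apply: none; exists j.
have grow j : j%:R * e <= node j.
  elim: j => [|j ih]; first by rewrite mul0r.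
  have := he (node j) (le_trans t0_ge0 (node_ge j)) (ltW (lt_B j)).
  by rewrite /= -natr1; lra.
exists (Num.truncn (B / e)).+1.
apply: le_trans (grow _); rewrite -ler_pdivrMr//; exact/ltW/truncnS_gt.
Qed.

Definition degree j : nat := Num.truncn (G (node j)).

Lemma degree_bounds j : (degree j)%:R <= G (node j) /\ G (node j) <= (degree j)%:R + 1.
Proof. exact/trunc_bounds/(le_trans ler01)/G_ge1/node_ge. Qed.

Lemma degree_gt0 j : (0 < degree j)%N.
Proof. by rewrite truncn_gt0 G_ge1// node_ge. Qed.

Lemma degree_leS j : (degree j)%:R <= (degree j.+1)%:R :> R.
Proof. by rewrite ler_nat le_truncn// (slope_le rg)// ltW// node_lt. Qed.

(** The weighted modulus, on the circle of radius [e^s], of the monomial normalised at node [j]. *)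
Definition term j s : R := expR (F (node j) + (degree j)%:R * (s - node j) - F s).

Let rho : R := expR (- (c / 2)).

(** At the later node the tangent gap gives the ratio; farther right the larger degree only improves
    it. *)
Lemma term_left j s : node j.+1 <= s -> term j s <= rho * term j.+1 s.
Proof.
move=> js; rewrite -expRD ler_expR.
have [st _] := step (node_ge j); have [d1 _] := degree_bounds j.
have dd := degree_leS j; have d0 := rg_dl rg (node j).
move: js st; rewrite /=; set y := node j + dl (node j); move=> js st.
have : (degree j)%:R * (s - y) <= (degree j.+1)%:R * (s - y) by rewrite ler_wpM2r// subr_ge0.
have : (degree j)%:R * dl (node j) <= G (node j) * dl (node j) by rewrite ler_pM2r.
have : (degree j)%:R * (s - node j) = (degree j)%:R * (s - y) + (degree j)%:R * dl (node j).
  by rewrite /y; ring.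
by have := c_gt0; lra.
Qed.

(** Here rounding the degree down costs up to [dl (node j) <= c / 2], which leaves half of the gap
    [c]; hence the choice of [rho]. *)
Lemma term_right j s : s <= node j -> term j.+1 s <= rho * term j s.
Proof.
move=> js; rewrite -expRD ler_expR.
have [_ st] := step (node_ge j); have [_ d1] := degree_bounds j.+1.
have dd := degree_leS j; have d0 := rg_dl rg (node j); have dc := dl_lec (node_ge j).
move: d1 st; rewrite /=; set y := node j + dl (node j); move=> d1 st.
have : (degree j.+1)%:R * (s - node j) <= (degree j)%:R * (s - node j).
  by rewrite ler_wnM2r// subr_le0.
have : (G y - 1) * dl (node j) <= (degree j.+1)%:R * dl (node j) by rewrite ler_pM2r//; lra.
have : (degree j.+1)%:R * (s - y) = (degree j.+1)%:R * (s - node j) - (degree j.+1)%:R * dl (node j).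
  by rewrite /y; ring.
by rewrite mulrBl mul1r; lra.
Qed.

(** Of the slope margin [k + 1], one unit absorbs the rounding of the degree and [k] units remain as
    decay. *)
Lemma term_le j s : term j s <= expR (C1 - k%:R * `|s - node j|).
Proof.
have d0 := rg_dl rg (node j); have d1 := dl_le1 (node_ge j).
have dV1 : 1 <= (dl (node j))^-1 by rewrite -invr1 lef_pV2 ?posrE.
rewrite ler_expR; have := gap s (node_ge j); set u := s - node j.
have [m1 m2] := degree_bounds j.
have u0 := normr_ge0 u; have uu := ler_norm u; have uN := ler_norm (- u).
rewrite normrN in uN.
have kk : k%:R * `|u| + `|u| <= (k%:R + 1) / dl (node j) * `|u|.
  rewrite -[X in _ + X]mul1r -mulrDl ler_wpM2r// ler_peMr// addr_ge0 ?ler0n//.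
have : (degree j)%:R * u <= G (node j) * u + `|u| by nra.
lra.
Qed.

Lemma term_leM j s : term j s <= expR C1.
Proof.
by apply: le_trans (term_le j s) _; rewrite ler_expR lerBlDr lerDl mulr_ge0.
Qed.

Lemma term_gt0 j s : 0 < term j s. Proof. exact: expR_gt0. Qed.

Let w : R := (1 - rho)^-1.

(** Induction on [K], using [w * rho = w - 1]. Right of the last node the sum is geometric. Left of
    it the slack [(w - 1) * term K s] pays for the next term; a point between the last two nodes
    passes from the first bound to the second. *)
Lemma sum_terms K s :
  (node K <= s -> \sum_(j < K.+1) term j s <= w * term K s) /\
  (s <= node K -> \sum_(j < K.+1) term j s <= 2 * w * expR C1 - (w - 1) * term K s).
Proof.
have rho0 : 0 < rho by exact: expR_gt0.
have rho1 : rho < 1 by rewrite -expR0 ltr_expR oppr_lt0 divr_gt0.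
have wE : w * (1 - rho) = 1 by rewrite /w mulVf// gt_eqF// subr_gt0.
have w1 : 1 < w by nra.
elim: K => [|K [ihl ihr]].
  rewrite big_ord1; have t1 := term_gt0 0 s; have t2 := term_leM 0 s.
  by split=> _; nra.
rewrite big_ord_recr /=.
have tK := term_gt0 K s; have tK1 := term_gt0 K.+1 s.
have tKM := term_leM K s; have tK1M := term_leM K.+1 s.
have nodeK := node_lt K.
split=> sK.
  have tl := term_left sK.
  have := ihl (le_trans (ltW nodeK) sK); nra.
have [/ihr {}ihr|Ks] := leP s (node K).
  have := term_right (s := s) (j := K); nra.
have := ihl (ltW Ks); nra.
Qed.

Let M : R := 2 * w * expR C1.

Let w_ge1 : 1 <= w.
Proof.
have rho0 : 0 < rho by exact: expR_gt0.
have rho1 : rho < 1 by rewrite -expR0 ltr_expR oppr_lt0 divr_gt0.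
by rewrite /w -[leLHS]invr1 lef_pV2 ?posrE ?subr_gt0//; lra.
Qed.

Lemma sum_terms_le K s : \sum_(j < K.+1) term j s <= M.
Proof.
have e0 := expR_gt0 C1; have t0' := term_gt0 K s; have tM := term_leM K s.
have := w_ge1; have [sl sr] := sum_terms K s.
have [/sr|/ltW/sl] := leP s (node K); rewrite /M; nra.
Qed.

Lemma sum_terms_decay K s : node K <= s ->
  \sum_(j < K.+1) term j s * expR (s - node K) ^+ k <= M.
Proof.
move=> Ks; rewrite -mulr_suml.
have [/(_ Ks) sl _] := sum_terms K s.
have := term_le K s; rewrite ger0_norm ?subr_ge0// => tK.
have E0 : 0 <= expR (s - node K) ^+ k by rewrite exprn_ge0 ?expR_ge0.
apply: le_trans (ler_wpM2r E0 sl) _; rewrite -mulrA.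
have : term K s * expR (s - node K) ^+ k <= expR C1.
  apply: le_trans (ler_wpM2r E0 tK) _.
  by rewrite -expRM_natl -expRD subrK.
have := w_ge1; rewrite /M; have := expR_gt0 C1.
set X := term K s * _; move=> ? ? ?; nra.
Qed.

Lemma node_between K s : t0 <= s -> s <= node K ->
  exists j : 'I_K.+1, node j <= s /\ s <= node j + dl (node j).
Proof.
move=> t0s; elim: K => [|K ih] sK.
  by exists ord0; split => //=; apply: le_trans sK _; rewrite lerDl ltW// (rg_dl rg).
have [/ih[j hj]|Ks] := leP s (node K); first by exists (widen_ord (leqnSn _) j).
by exists (inord K); rewrite inordK//; split => //; exact: ltW.
Qed.

Lemma term_ge j s : node j <= s -> s <= node j + dl (node j) ->
  expR (- (C2 + 1)) <= term j s.
Proof.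
move=> js sj; rewrite ler_expR.
have d1 := dl_le1 (node_ge j); have [m1 m2] := degree_bounds j.
have := near (t := node j) (s := s) (node_ge j).
rewrite ger0_norm ?subr_ge0// lerBlDl => /(_ sj).
have : (G (node j) - 1) * (s - node j) <= (degree j)%:R * (s - node j).
  by rewrite ler_wpM2r ?subr_ge0//; lra.
by rewrite mulrBl mul1r; lra.
Qed.

Definition node_poly j : {poly R} :=
  expR (F (node j)) *: ((expR (node j))^-1 *: 'X) ^+ degree j.

Lemma nneg_node_poly j : nneg_poly (node_poly j).
Proof.
apply: nneg_polyZ; first exact: expR_ge0.
apply: nneg_poly_exp; apply: nneg_polyZ; first by rewrite invr_ge0 expR_ge0.
exact: nneg_polyX.
Qed.

Lemma cmod_node_poly j z : cmod (pev (node_poly j) z) =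
  expR (F (node j)) * (cmod z / expR (node j)) ^+ degree j.
Proof.
rewrite /node_poly pevZ cmodM cmod_real ger0_norm ?expR_ge0// pev_exp cmodX.
by rewrite pevZ pevX cmodM cmod_real ger0_norm ?invr_ge0 ?expR_ge0// [_^-1 * _]mulrC.
Qed.

Lemma term_node_poly j z s : cmod z = expR s ->
  cmod (pev (node_poly j) z) * expR (- phi (cmod z)) = term j s.
Proof.
move=> zs; rewrite cmod_node_poly zs -expRN -expRD -expRM_natl -!expRD.
by congr expR; ring.
Qed.

Definition subset_poly K (S : {set 'I_K.+1}) : {poly R} :=
  \sum_(j in S) node_poly j.

Lemma nneg_subset_poly K (S : {set 'I_K.+1}) : nneg_poly (subset_poly S).
Proof. by apply: nneg_poly_sum => j; exact: nneg_node_poly. Qed.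

Lemma subset_poly_le K (S : {set 'I_K.+1}) z s : cmod z = expR s ->
  cmod (pev (subset_poly S) z) * expR (- phi (cmod z)) <= \sum_(j < K.+1) term j s.
Proof.
move=> zs; rewrite /subset_poly pev_sum.
apply: (@le_trans _ _ (\sum_(j in S) term j s)).
  have -> : \sum_(j in S) term j s =
      (\sum_(j in S) cmod (pev (node_poly j) z)) * expR (- phi (cmod z)).
    by rewrite mulr_suml; apply: eq_bigr => j _; rewrite (term_node_poly _ zs).
  by rewrite ler_wpM2r ?expR_ge0// cmod_sum.
rewrite [leRHS](bigID (mem S)) /= lerDl sumr_ge0// => j _.
exact/ltW/term_gt0.
Qed.

(** Inside the disc of radius [e^(node K)] the uniform bound on the sum of all terms suffices;
    outside, the decay of the last term absorbs the [k]-th power of the modulus. *)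
Lemma subset_poly_decays K (S : {set 'I_K.+1}) :
  decays phi (pev (subset_poly S)) M 0 (expR (node K)) k.
Proof.
have M0 : 0 <= M by rewrite !mulr_ge0 ?expR_ge0// (le_trans ler01).
have b0 : 0 <= expR (node K) ^+ k by rewrite exprn_ge0 ?expR_ge0.
move=> z; rewrite rmorph0 subr0.
have [->|z0] := eqVneq z 0.
  have -> : cmod (pev (subset_poly S) 0) = 0.
    apply/eqP; rewrite eq_le cmod_ge0 andbT /subset_poly pev_sum.
    apply: le_trans (cmod_sum _ _ _) _; rewrite big1// => j _.
    by rewrite cmod_node_poly cmod0 mul0r expr0n gtn_eqF ?degree_gt0// mulr0.
  by rewrite !mul0r; split=> //; rewrite mulr_ge0.
have [s zs] := cmod_gt0_expR z0; have le_sum := subset_poly_le S zs.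
have W := le_trans le_sum (sum_terms_le K s).
split => //; set x := cmod _ * _ in le_sum W *.
have x0 : 0 <= x by rewrite mulr_ge0 ?cmod_ge0 ?expR_ge0.
have [sK|/ltW Ks] := leP s (node K).
  apply: ler_pM => //; first by rewrite exprn_ge0 ?cmod_ge0.
  by rewrite zs lerXn2r ?nnegrE ?expR_ge0// ler_expR.
have -> : cmod z = expR (s - node K) * expR (node K) by rewrite -expRD subrK.
rewrite exprMn mulrA ler_wpM2r//.
apply: le_trans (sum_terms_decay Ks); rewrite -mulr_suml.
by rewrite ler_wpM2r// exprn_ge0 ?expR_ge0.
Qed.

Lemma subset_poly_large q K z : 0 < q -> expR t0 <= cmod z -> cmod z <= expR (node K) ->
  #|{set 'I_K.+1}|%:R * (expR (- (C2 + 1)) / 2) `^ q / 2 <=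
    \sum_(S : {set 'I_K.+1})
      (cmod (pev (subset_poly S) z) * expR (- phi (cmod z))) `^ q.
Proof.
move=> q0 tz zK.
have z0 : z != 0.
  by apply/eqP => zE; move: tz; rewrite zE cmod0 leNgt expR_gt0.
have [s zs] := cmod_gt0_expR z0.
have [j [js sj]] : exists j : 'I_K.+1, node j <= s /\ s <= node j + dl (node j).
  by apply: node_between; rewrite -ler_expR -zs.
pose e := real_complex R (expR (- phi (cmod z))).
have ce : cmod e = expR (- phi (cmod z)) by rewrite cmod_real ger0_norm ?expR_ge0.
pose a (i : 'I_K.+1) := pev (node_poly i) z * e.
have aj : expR (- (C2 + 1)) <= cmod (a j).
  by rewrite cmodM ce (term_node_poly _ zs) term_ge.
have := subset_sums_large q0 (expR_ge0 _) aj; congr (_ <= _).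
apply: eq_bigr => S _; congr (_ `^ q).
by rewrite /subset_poly pev_sum -ce -cmodM mulr_suml.
Qed.

End Nodes.

(** The pointwise lower bound for the sum over all subsets is integrated over a rectangle; some
    subset then achieves at least half of the average bound. *)
Lemma spread (q : R) : 0 < q -> exists C c, [/\ 0 < C, 0 < c & forall B, exists b P,
  [/\ B <= b, 0 < b, nneg_poly P, decays phi (pev P) C 0 b k &
    ((c * b ^+ 2)%:E <= fock_int phi (box b) q (pev P))%E]].
Proof.
move=> q0.
have [c c0 [t1 step]] := tangent_gap rg.
have k0 : 0 < k%:R + 1 :> R by rewrite ltr_wpDl.
have [C1 [t2 [C1_gt0 gap]]] := tangent_linear_gap rg k0.
have [C2 [t3 [C2_gt0 near]]] := tangent_near rg.
have [t4 dl1] := dl_small rg ltr01.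
have c20 : 0 < c / 2 by rewrite divr_gt0.
have [t5 dlc] := dl_small rg c20.
have [t6 G1] := slope_large rg 1.
pose t0 := Num.max 0 (Num.max (Num.max t1 t2) (Num.max (Num.max t3 t4) (Num.max t5 t6))).
have maxP t : t0 <= t -> [/\ 0 <= t, t1 <= t /\ t2 <= t, t3 <= t /\ t4 <= t & t5 <= t /\ t6 <= t].
  by rewrite !ge_max => /andP[-> /andP[/andP[-> ->] /andP[/andP[-> ->] /andP[-> ->]]]].
have t0_ge0 : 0 <= t0 by have [] := maxP _ (lexx t0).
have {}G1 t : t0 <= t -> 1 <= G t by move=> /maxP[_ _ _ [_ /G1]].
have {}dl1 t : t0 <= t -> dl t <= 1 by move=> /maxP[_ _ [_ /dl1]].
have {}dlc t : t0 <= t -> dl t <= c / 2 by move=> /maxP[_ _ _ [/dlc]].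
have {}step t := fun h : t0 <= t => step t (let: And4 _ (conj h1 _) _ _ := maxP t h in h1).
have {}near t s := fun h : t0 <= t => near t s (let: And4 _ _ (conj h1 _) _ := maxP t h in h1).
have {}gap t s := fun h : t0 <= t => gap t s (let: And4 _ (conj _ h1) _ _ := maxP t h in h1).
set M := 2 * (1 - expR (- (c / 2)))^-1 * expR C1.
have M0 : 0 < M.
  by rewrite !mulr_gt0 ?expR_gt0// invr_gt0 subr_gt0 expR_lt1 oppr_lt0.
pose v := (expR (- (C2 + 1)) / 2) `^ q.
have v0 : 0 < v by rewrite powR_gt0// divr_gt0 ?expR_gt0.
have v320 : 0 < v / 32 by rewrite divr_gt0.
(* The average is at least [v / 16]: [1 / 2] from toggling a node and [1 / 8] from the area of the
   rectangle. Halving it leaves the strict margin needed for the contradiction. *)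
exists M, (v / 32); split; [exact: M0|exact: v320|].
move=> B.
have [K hK] := node_unbounded t0_ge0 (ln (Num.max B (2 * expR t0))).
pose b := expR (node t0 K); have b0 : 0 < b by exact: expR_gt0.
have Bb : Num.max B (2 * expR t0) <= b.
  by apply: ln_le_expR => //; rewrite lt_max mulr_gt0 ?expR_gt0 ?orbT.
move: Bb; rewrite ge_max => /andP[Bb tb].
(* The rectangle lies in the annulus covered by the nodes: [b / 2 >= e^t0], and
   [(3/4)^2 + (1/2)^2 < 1]. *)
pose Q : set (plane R) := `[b / 2, 3 * b / 4] `*` `[0, b / 2].
have mQ : measurable Q by exact: measurableX.
have QE : area R Q = (b ^+ 2 / 8)%:E.
  by rewrite /Q area_rectangle; [congr EFin; field|lra|lra].
have Qz w : Q w -> expR t0 <= cmod (toC w) /\ cmod (toC w) <= b.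
  case: w => x y [hx hy].
  have /andP[x1 x2] : b / 2 <= x <= 3 * b / 4 by have := hx; rewrite /= in_itv.
  have /andP[y1 y2] : 0 <= y <= b / 2 by have := hy; rewrite /= in_itv.
  split.
    apply: le_trans (cmod_ge_Re _) => /=; rewrite ger0_norm; lra.
  rewrite -(@ler_pXn2r _ 2) ?nnegrE ?cmod_ge0 ?(ltW b0)// cmod_sqr /=; nra.
pose J (S : {set 'I_K.+1}) := fock_int phi Q q (pev (subset_poly t0 S)).
have mS (S : {set 'I_K.+1}) := measurable_wmod_pow mphi q (D := Q)
  (cmeasurable_pev (subset_poly t0 S)).
have sumJ : ((#|{set 'I_K.+1}|%:R * v / 2 * (b ^+ 2 / 8))%:E <= \sum_S J S)%E.
  rewrite -ge0_integral_sum//; last by move=> S w _; rewrite lee_fin powR_ge0.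
  rewrite EFinM -QE -integral_cst//; apply: ge0_le_integral => //.
  - by move=> w _; rewrite lee_fin !mulr_ge0// ltW.
  - exact: emeasurable_sum.
  move=> w /Qz[w1 w2]; rewrite sumEFin lee_fin.
  exact: (subset_poly_large G1 dl1 near q0 w1 w2).
have [S JS] : exists S, ((v / 32 * b ^+ 2)%:E <= J S)%E.
  have [//|none] := pselect (exists S, ((v / 32 * b ^+ 2)%:E <= J S)%E).
  exfalso.
  have : (\sum_S J S <= \sum_(S : {set 'I_K.+1}) (v / 32 * b ^+ 2)%:E)%E.
    apply: lee_sum => S _; rewrite leNgt; apply/negP => /ltW JS.
    by apply: none; exists S.
  rewrite sumEFin sumr_const -mulr_natl => /(le_trans sumJ); rewrite lee_fin.
  have : 0 < #|{set 'I_K.+1}|%:R :> R by rewrite ltr0n; apply/card_gt0P; exists finset.set0.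
  have vb : 0 < v * b ^+ 2 by rewrite mulr_gt0 ?exprn_gt0.
  nra.
exists b, (subset_poly t0 S); split => //.
- exact: nneg_subset_poly.
- exact: (subset_poly_decays c0 G1 dl1 dlc step gap).
- apply: le_trans JS _; apply: ge0_subset_integral => //.
  + exact: measurableX.
  + by apply: measurable_wmod_pow => //; exact: cmeasurable_pev.
  + by move=> w _; rewrite lee_fin powR_ge0.
  + by clear - b0; apply: rectangle_sub_box; lra.
Qed.

End Spread.

(** * Fock spaces are not nested *)

Section Humps.
Variables (R : realType) (phi G H dl : R -> R).
Hypothesis mphi : measurable_fun setT (fun w : plane R => phi (cmod (toC w))).
Hypothesis rg : regular_growth (fun t : R => phi (expR t)) G H dl.
Variables p q : R.
Hypotheses (p0 : 0 < p) (q0 : 0 < q).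

Let k : nat := (Num.truncn (4 / p + 4 / q)).+1.

Let kp : 4 <= k%:R * p.
Proof.
rewrite -ler_pdivrMr//; apply: (@le_trans _ _ (4 / p + 4 / q)); last exact/ltW/truncnS_gt.
by rewrite lerDl divr_ge0// ltW.
Qed.

Let kq : 4 <= k%:R * q.
Proof.
rewrite -ler_pdivrMr//; apply: (@le_trans _ _ (4 / p + 4 / q)); last exact/ltW/truncnS_gt.
by rewrite lerDr divr_ge0// ltW.
Qed.

(** [2 / t] is the midpoint of [p] and [q], so [2 - p * t] and [2 - q * t] have opposite signs. *)
Let t : R := 4 / (p + q).

Let tE : t * (p + q) = 4.
Proof. by rewrite divfK// gt_eqF// addr_gt0. Qed.

Let t0 : 0 < t. Proof. by rewrite divr_gt0// addr_gt0. Qed.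

Let t_between : p < q -> p * t < 2 /\ 2 < q * t.
Proof.
rewrite -subr_gt0 => pq; have := mulr_gt0 t0 pq; have := tE.
by rewrite mulrBr mulrDr ![t * _]mulrC => ? ?; split; lra.
Qed.

Let t_between' : q < p -> q * t < 2 /\ 2 < p * t.
Proof.
rewrite -subr_gt0 => pq; have := mulr_gt0 t0 pq; have := tE.
by rewrite mulrBr mulrDr ![t * _]mulrC => ? ?; split; lra.
Qed.

Lemma decays_horner C a sigma (P : {poly R}) (r : R) :
  0 <= r -> nneg_poly P -> decays phi (pev P) C a sigma k ->
  P.[r] <= C * expR (phi r) /\
  P.[r] * `|r - a| ^+ k <= C * sigma ^+ k * expR (phi r).
Proof.
move=> r0 Pnn /(_ (real_complex R r)).
have Pr0 := horner_nneg_ge0 Pnn r0.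
rewrite pev_real -rmorphB !cmod_real (ger0_norm Pr0) (ger0_norm r0) => -[h1 h2].
have e0 := expR_gt0 (phi r); have eN : expR (- phi r) * expR (phi r) = 1.
  by rewrite -expRD addrC subrr expR0.
split.
  have := ler_wpM2r (ltW e0) h1; by rewrite -mulrA eN mulr1.
have := ler_wpM2r (ltW e0) h2.
by rewrite mulrAC -[P.[r] * _ * _]mulrA eN mulr1.
Qed.

(** The small parameter is the width [x = e^s * dl s] of the peak itself. On a fixed disc the decay
    of order [k] gives [x ^+ k], which beats the scaling [x^(- t)] because [k * p >= 4 > p * t]. *)
Lemma humps_concentrated : p < q -> humps phi p q.
Proof.
move=> /t_between[pt qt].
have [C [t1 [C0 conc]]] := concentrated rg k.
have c0 : 0 < C^-1 `^ q / 16 ^+ 2 by rewrite divr_gt0 ?exprn_gt0// powR_gt0// invr_gt0.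
apply: (humps_of_family mphi (s := 1) (t := t) (g := k%:R) p0 q0 kp kq C0 c0).
- by rewrite mul1r subr_gt0.
- by rewrite mul1r subr_lt0.
- rewrite mul1r subr_gt0 -(ltr_pM2r p0) mulrC; have := kp; lra.
move=> r r0; exists (C * expR (phi r)); first by rewrite mulr_gt0 ?expR_gt0.
move=> x0 /(rg_tau rg)[t2 ht2].
pose s := Num.max (Num.max t1 t2) (ln (r + 1)).
have s1 : t1 <= s by rewrite !le_max lexx.
have s2 : t2 <= s by rewrite !le_max lexx orbT.
have s3 : ln (r + 1) <= s by rewrite le_max lexx orbT.
have {s3} ra : r + 1 <= expR s by apply: ln_le_expR => //; lra.
have [P [Pnn Pdec Plow]] := conc s s1.
set x := expR s * dl s in Pdec Plow; set a := expR s in ra Pdec Plow.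
have x_gt0 : 0 < x by rewrite mulr_gt0 ?expR_gt0 ?(rg_dl rg).
have a0 : 0 < a by exact: expR_gt0.
have xE : x `^ 1 = x by rewrite powRr1// ltW.
exists x, a, P, (a + x); rewrite xE; split => //.
- by rewrite x_gt0 ht2.
- pose Q : set (plane R) := `[a, a + x / 16] `*` `[0, x / 16].
  have mQ : measurable Q by exact: measurableX.
  have QE : area R Q = ((x / 16) ^+ 2)%:E.
    by rewrite /Q area_rectangle; [congr EFin; field|lra|lra].
  have mP D := measurable_wmod_pow mphi q (D := D) (cmeasurable_pev P).
  apply: (@le_trans _ _ (fock_int phi Q q (pev P))); last first.
    apply: ge0_subset_integral => //.
    + exact: measurableX.
    + by move=> w _; rewrite lee_fin powR_ge0.
    + by apply: rectangle_sub_box; lra.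
  have -> : C^-1 `^ q / 16 ^+ 2 * x ^+ 2 = C^-1 `^ q * (x / 16) ^+ 2 by field.
  rewrite EFinM -QE -integral_cst//; apply: ge0_le_integral => //.
  + by move=> w _; rewrite lee_fin powR_ge0.
  + move=> [u v] [hu hv].
    have /andP[u1 u2] : a <= u <= a + x / 16 by have := hu; rewrite /= in_itv.
    have /andP[v1 v2] : 0 <= v <= x / 16 by have := hv; rewrite /= in_itv.
    rewrite lee_fin; apply: powR_mono; [exact: ltW|by rewrite invr_ge0 ltW|].
    have -> : u = a + (u - a) by ring.
    by apply: Plow; apply/andP; split; lra.
- have [_] := decays_horner r0 Pnn Pdec.
  rewrite (powR_mulrn _ (ltW x_gt0)) mulrAC; apply: le_trans.
  rewrite ler_peMr ?horner_nneg_ge0// exprn_ege1// ler0_norm; lra.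
Qed.

(** The small parameter is [1 / b], whence [s = -1]. The values on a fixed disc are merely bounded,
    so [g = 0], but the scaling factor [b^(- t)] tends to 0 by itself. *)
Lemma humps_spread : q < p -> humps phi p q.
Proof.
move=> /t_between'[qt pt].
have [C [c [C0 c0 spr]]] := spread mphi rg k q0.
apply: (humps_of_family mphi (s := -1) (t := t) (g := 0) p0 q0 kp kq C0 c0).
- by rewrite mulN1r oppr_gt0 subr_lt0.
- by rewrite mulN1r oppr_lt0 subr_gt0.
- by rewrite mulN1r opprK add0r.
move=> r r0; exists (C * expR (phi r)); first by rewrite mulr_gt0 ?expR_gt0.
move=> x0 x0_gt0; have [b [P [Bb b0 Pnn Pdec Plow]]] := spr x0^-1.
exists b^-1, 0, P, b.
have bE : b^-1 `^ (-1) = b by rewrite powR_inv1 ?invrK// invr_ge0 ltW.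
rewrite bE; split => //.
- by rewrite invr_gt0 b0 -[leRHS]invrK lef_pV2 ?posrE ?invr_gt0.
- by rewrite powRr0 mulr1; have [] := decays_horner r0 Pnn Pdec.
Qed.

End Humps.

(** Differentiability gives continuity on the open half-line, and adjoining the single point 0
    preserves measurability. *)
Lemma measurable_radial (R : realType) (phi : R -> R) :
  (forall x : R, 0 <= x -> derivable0y phi x) ->
  measurable_fun setT (fun w : plane R => phi (cmod (toC w))).
Proof.
move=> dphi.
have mo : measurable_fun (`]0, +oo[ : set R) phi.
  apply: open_continuous_measurable_fun; first exact: interval_open.
  move=> x; rewrite inE /= in_itv/= andbT => x0.
  have := derivable0y_is_derive x0 (dphi x (ltW x0)).
  by move=> h; apply: differentiable_continuous; apply/derivable1_diffP.
have mc : measurable_fun (`[0, +oo[ : set R) phi by exact/measurable_fun_itv_obnd_cbndP.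
apply: (measurable_comp _ _ mc (@measurable_cmod_toC R)) => //.
by move=> _ [w _ <-]; have := cmod_ge0 (toC w); rewrite /= in_itv/= andbT.
Qed.

Theorem corollary2 (R : realType) (phi : R -> R)
    (hphi : rapidly_increasing phi) :
  ~ nested (fock phi) /\
  forall p q : R, 0 < p -> 0 < q -> p <> q ->
    (fock phi p `\` fock phi q !=set0) /\ (fock phi q `\` fock phi p !=set0).
Proof.
have [phi_ge0 [dphi _ _] _ _] := hphi.
have mphi := measurable_radial dphi.
have [G [H [dl rg]]] := rapidly_increasing_growth hphi.
have diff p q : 0 < p -> 0 < q -> p <> q -> fock phi p `\` fock phi q !=set0.
  move=> p0 q0 /eqP; rewrite neq_lt => /orP pq.
  apply: (gliding_hump phi_ge0 mphi p0 q0).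
  by case: pq => pq; [apply: humps_concentrated|apply: humps_spread] => //; exact: rg.
split=> [nest|p q p0 q0 pq]; last by split; apply: diff => // /esym.
have n12 : (1 : R) <> 2 by lra.
have two0 : 0 < 2 :> R by lra.
have [sub|sub] := nest 1 2 ltr01 two0.
- by have [f [f1]] := diff 1 2 ltr01 two0 n12; apply; exact: sub.
- by have [f [f2]] := diff 2 1 two0 ltr01 (nesym n12); apply; exact: sub.
Qed.
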